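(* Let $V$ be a simple vertex operator algebra, $G$ a finite group of automorphisms of $V$, and $M$ an irreducible $V$-module. Let $G_M=\{g\in G\mid M\circ g\cong M\}$, let $\alpha_M$ be the 2-cocycle of the projective representation of $G_M$ on $M$, and let $\Lambda_{G_M,\alpha_M}$ be the set of irreducible characters of the twisted group algebra $\mathbb C^{\alpha_M}[G_M]$ (see context). For $\lambda\in\Lambda_{G_M,\alpha_M}$ let $M^\lambda$ be the $W_\lambda$-isotypic component of $M$ and $M_\lambda$ the multiplicity space of $W_\lambda$ in $M$. Then: 1) $M^\lambda$ is nonzero for every $\lambda\in\Lambda_{G_M,\alpha_M}$. 2) Each $M_\lambda$ is an irreducible $V^G$-module. 3) $M_\lambda$ and $M_\gamma$ are equivalent $V^G$-modules if and only if $\lambda=\gamma$. That is, $V^G$ and $\mathbb C^{\alpha_M}[G_M]$ form a dual pair on $M$.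
   Context: Vertex operator algebras $V=(V,Y,\mathbf 1,\omega)$ are over $\mathbb C$ in the usual sense (Borcherds, Frenkel–Lepowsky–Meurman): $V=\bigoplus_{n\in\mathbb Z}V_n$ with $\dim V_n<\infty$ and $V_n=0$ for $n$ sufficiently negative. $V$ is simple if it has no nontrivial ideals. An automorphism of $V$ is a linear automorphism $g$ with $g\mathbf 1=\mathbf 1$, $g\omega=\omega$, $gY(v,z)g^{-1}=Y(gv,z)$. $V^G=\{v\in V\mid gv=v\ \forall g\in G\}$ is a vertex operator subalgebra. A weak $V$-module $M$ is a vector space with a linear map $v\mapsto Y_M(v,z)=\sum_{n\in\mathbb Q}v_nz^{-n-1}$, $v_n\in\mathrm{End}\,M$, such that for $u,v\in V$, $w\in M$: $u_lw=0$ for $l\gg0$, $Y_M(\mathbf 1,z)=1$, and the Jacobi identity $z_0^{-1}\delta(\frac{z_1-z_2}{z_0})Y_M(u,z_1)Y_M(v,z_2)-z_0^{-1}\delta(\frac{z_2-z_1}{-z_0})Y_M(v,z_2)Y_M(u,z_1)=z_2^{-1}\delta(\frac{z_1-z_0}{z_2})Y_M(Y(u,z_0)v,z_2)$ holds, with $\delta(z)=\sum_{n\in\mathbb Z}z^n$. A $V$-module is a weak $V$-module $M=\bigoplus_{\lambda\in\mathbb C}M_\lambda$ with the $L(0)$-eigenspaces $M_\lambda$ (eigenvalue $\lambda$) finite dimensional and, for fixed $\lambda$, $M_{\lambda+n}=0$ for all sufficiently small integers $n$; here $Y_M(\omega,z)=\sum_n L(n)z^{-n-2}$. For $g\in G$,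 $M\circ g$ is the $V$-module equal to $M$ as a vector space with $Y_{M\circ g}(v,z)=Y_M(gv,z)$. For $g\in G_M$ fix a linear isomorphism $\phi(g):M\to M$ with $\phi(g)Y_M(v,z)\phi(g)^{-1}=Y_M(gv,z)$ for all $v\in V$, with $\phi(1)=\mathrm{id}$. By Schur's lemma $\phi(g)\phi(h)=\alpha_M(g,h)\phi(gh)$ with $\alpha_M(g,h)\in\mathbb C^*$, and $\alpha_M$ is a 2-cocycle on $G_M$. The twisted group algebra $\mathbb C^{\alpha_M}[G_M]$ has basis $\{\bar g\mid g\in G_M\}$ and product $\bar x\bar y=\alpha_M(x,y)\overline{xy}$; it acts on $M$ by $\bar g\mapsto\phi(g)$, and this action commutes with $V^G$. $W_\lambda$ denotes the simple $\mathbb C^{\alpha_M}[G_M]$-module with character $\lambda$; $M^\lambda$ is the sum of all $\mathbb C^{\alpha_M}[G_M]$-submodules of $M$ isomorphic to $W_\lambda$, so $M=\bigoplus_\lambda M^\lambda$ and $M^\lambda=W_\lambda\otimes M_\lambda$ with $M_\lambda=\mathrm{Hom}_{\mathbb C^{\alpha_M}[G_M]}(W_\lambda,M)$, on which $V^G$ acts through its action on $M$. ''Dual pair'' summarizes 1)–3): every simple module of the algebra occurs in $M$, its multiplicity space is an irreducible $V^G$-module, and different multiplicity spaces are inequivalent. *)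

(* Defs.v *)
From HB Require Import structures.
From mathcomp Require Import all_boot all_order all_algebra all_fingroup.
From mathcomp Require Import complex.
From mathcomp Require Import boolp classical_sets functions cardinality fsbigop.
From mathcomp Require Import reals.

Set Implicit Arguments.
Unset Strict Implicit.
Unset Printing Implicit Defensive.

Import Order.TTheory GRing.Theory Num.Theory.

Local Open Scope classical_set_scope.
Local Open Scope ring_scope.

(* Throughout, R is any model of the real numbers and the ground field is
   R[i], the field of complex numbers. *)

Section LinearAlgebra.
Variables (R : realType) (M : lmodType R[i]).

Definition is_subspace (N : set M) : Prop :=
  N 0 /\ forall (a : R[i]) x y, N x -> N y -> N (a *: x + y).

(* A subspace is finite dimensional iff it lies in the span of a finite
   family; the family itself need not lie in U. *)
Definition fin_dim (U : set M) : Prop :=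
  exists (n : nat) (b : 'I_n -> M),
    forall x, U x -> exists c : 'I_n -> R[i], x = \sum_(i < n) c i *: b i.

(* The sum of a family of subspaces: finite sums of elements of its members. *)
Definition sum_subspaces (F : set (set M)) : set M :=
  [set x | exists s : seq M,
    (forall y, y \in s -> exists2 N, F N & N y) /\ x = \sum_(y <- s) y].

Definition eigenspace_of (T : M -> M) (a : R[i]) : set M :=
  [set x | T x = a *: x].

End LinearAlgebra.

(* The generalized binomial coefficient x (x - 1) ... (x - i + 1) / i!. *)
Definition gbinom (R : realType) (x : R[i]) (i : nat) : R[i] :=
  (\prod_(j < i) (x - j%:R)) / (i`!)%:R.

(* Y(u, z) = \sum_(n : int) (mode u n) z^(-n-1). *)
Record vertex_data (R : realType) := VertexData {
  vcar :> lmodType R[i];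
  mode : vcar -> int -> vcar -> vcar;
  vacuum : vcar;
  conformal : vcar
}.
Arguments mode {R v}.
Arguments vacuum {R}.
Arguments conformal {R}.

Section VertexOperatorAlgebra.
Variables (R : realType) (V : vertex_data R).

(* omega_(n+1) = L(n). *)
Definition vL (n : int) : V -> V := mode (conformal V) (n + 1).

(* The coefficient of z_0^(-l-1) z_1^(-m-1) z_2^(-n-1) in the Jacobi identity
   applied to w, the binomials (z_1 - z_2)^l, (z_2 - z_1)^l, (z_1 - z_0)^k
   being expanded in nonnegative powers of their second variable; on the right
   (-1)^i gbinom (i - m - 1) i has been written gbinom m i.  The sums are
   finitely supported by the truncation property. *)
Definition jacobi_identity : Prop :=
  forall (u v w : V) (l m n : int),
    (\sum_(i \in [set: nat]) ((-1) ^+ i * gbinom (l%:~R : R[i]) i) *: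
        mode u (m + l - i%:Z) (mode v (n + i%:Z) w))
    - (-1) ^ l *: (\sum_(i \in [set: nat]) ((-1) ^+ i * gbinom (l%:~R : R[i]) i) *:
        mode v (n + l - i%:Z) (mode u (m + i%:Z) w))
    = \sum_(i \in [set: nat]) gbinom (m%:~R : R[i]) i *:
        mode (mode u (l + i%:Z) v) (m + n - i%:Z) w.

(* V_n is the L(0)-eigenspace of eigenvalue n, so that the sum of the V_n is
   automatically direct. *)
Record is_voa : Prop := IsVoa {
  mode_linearl : forall n w, linear (fun u : V => mode u n w);
  mode_linearr : forall u n, linear (mode u n : V -> V);
  mode_truncation : forall u w : V,
    exists N : int, forall n, N <= n -> mode u n w = 0;
  mode_vacuum : forall n (w : V),
    mode (vacuum V) n w = if n == -1 then w else 0;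
  mode_creation : forall u : V, mode u (-1) (vacuum V) = u;
  mode_creation0 : forall (u : V) n, 0 <= n -> mode u n (vacuum V) = 0;
  mode_jacobi : jacobi_identity;
  virasoro : exists c : R[i], forall (m n : int) (w : V),
    vL m (vL n w) - vL n (vL m w) = (m - n)%:~R *: vL (m + n) w
      + (if m + n == 0 then (m%:~R ^+ 3 - m%:~R) / 12%:R * c else 0) *: w;
  vL_derivative : forall (u : V) n w,
    mode (vL (-1) u) n w = - n%:~R *: mode u (n - 1) w;
  voa_graded :
    sum_subspaces (range (fun n : int => eigenspace_of (vL 0) n%:~R)) = setT;
  voa_fin_dim : forall n : int, fin_dim (eigenspace_of (vL 0) n%:~R);
  voa_bounded : exists N : int, forall n : int, n <= N ->
    eigenspace_of (vL 0) n%:~R = [set 0];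
  vacuum_weight : vL 0 (vacuum V) = 0;
  conformal_weight : vL 0 (conformal V) = 2%:R *: conformal V
}.

Definition is_ideal (I : set V) : Prop :=
  is_subspace I /\
  forall (u v : V) n, I v -> I (mode u n v) /\ I (mode v n u).

Definition voa_simple : Prop :=
  forall I : set V, is_ideal I -> I = [set 0] \/ I = setT.

Definition is_automorphism (g : V -> V) : Prop :=
  [/\ linear g, bijective g, g (vacuum V) = vacuum V,
      g (conformal V) = conformal V &
      forall u n v, g (mode u n v) = mode (g u) n (g v)].

(* G acts faithfully by automorphisms, i.e., it is identified with a finite
   subgroup of Aut V; products act as composites. *)
Record aut_group (G : finGroupType) := AutGroup {
  ag_fun :> G -> V -> V;
  ag_aut : forall g, is_automorphism (ag_fun g);
  ag_mul : forall g h v, ag_fun (g * h)%g v = ag_fun g (ag_fun h v);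
  ag_faithful : forall g h, ag_fun g =1 ag_fun h -> g = h
}.

(* Y_M(v, z) = \sum_(n : rat) (mmode v n) z^(-n-1). *)
Record module_data := ModuleData {
  mcar :> lmodType R[i];
  mmode : V -> rat -> mcar -> mcar
}.

End VertexOperatorAlgebra.
Arguments mmode {R V m}.
Arguments ModuleData {R V} mcar mmode.

Record voa (R : realType) := Voa {
  voa_data :> vertex_data R;
  voaP : is_voa voa_data
}.

Section Modules.
Variables (R : realType) (V : vertex_data R).

Definition mL (M : module_data V) (n : int) : M -> M :=
  mmode (conformal V) (n%:~R + 1).

(* The same coefficient extraction as in jacobi_identity, for rational m and n;
   only integral powers of z_1 occur on the right-hand side of the Jacobi
   identity. *)
Definition module_jacobi (M : module_data V) : Prop :=
  forall (u v : V) (w : M) (l : int) (m n : rat),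
    (\sum_(i \in [set: nat]) ((-1) ^+ i * gbinom (l%:~R : R[i]) i) *:
        mmode u (m + l%:~R - i%:R) (mmode v (n + i%:R) w))
    - (-1) ^ l *: (\sum_(i \in [set: nat]) ((-1) ^+ i * gbinom (l%:~R : R[i]) i) *:
        mmode v (n + l%:~R - i%:R) (mmode u (m + i%:R) w))
    = if m \is a Num.int then
        \sum_(i \in [set: nat]) gbinom (ratr m : R[i]) i *:
          mmode (mode u (l + i%:Z) v) (m + n - i%:R) w
      else 0.

Record is_weak_module (M : module_data V) : Prop := IsWeakModule {
  mmode_linearl : forall n w, linear (fun u : V => mmode u n w : M);
  mmode_linearr : forall u n, linear (mmode u n : M -> M);
  mmode_truncation : forall (u : V) (w : M),
    exists N : rat, forall n, N <= n -> mmode u n w = 0;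
  mmode_vacuum : forall n (w : M),
    mmode (vacuum V) n w = if n == -1 then w else 0;
  mmode_jacobi : module_jacobi M
}.

Record is_module (M : module_data V) : Prop := IsModule {
  module_weak : is_weak_module M;
  module_graded : sum_subspaces (range (eigenspace_of (@mL M 0))) = setT;
  module_fin_dim : forall a, fin_dim (eigenspace_of (@mL M 0) a);
  module_bounded : forall a, exists N : int, forall n : int, n <= N ->
    eigenspace_of (@mL M 0) (a + n%:~R) = [set 0]
}.

Definition is_submodule (M : module_data V) (N : set M) : Prop :=
  is_subspace N /\ forall (v : V) n w, N w -> N (mmode v n w).

Definition irreducible_module (M : module_data V) : Prop :=
  [/\ is_module M, exists w : M, w != 0 &
      forall N : set M, is_submodule N -> N = [set 0] \/ N = setT].

Definition module_iso (M N : module_data V) : Prop :=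
  exists f : M -> N, [/\ linear f, bijective f &
    forall v n w, f (mmode v n w) = mmode v n (f w)].

Record irr_module := IrrModule {
  irr_data :> module_data V;
  irrP : irreducible_module irr_data
}.

Definition twist_module (M : module_data V) (g : V -> V) : module_data V :=
  ModuleData (mcar M) (fun v n w => mmode (g v) n w).

End Modules.

Section Inertia.
Variables (R : realType) (V : voa R) (G : finGroupType) (rho : aut_group V G).

Lemma ag1 v : rho 1%g v = v.
Proof.
have [_ b _ _ _] := ag_aut rho 1%g.
by apply: (bij_inj b); rewrite -ag_mul mulg1.
Qed.

Variable M : module_data V.

Definition inertia : {set G} :=
  [set g | `[< module_iso (twist_module M (rho g)) M >]]%SET.

Lemma inertia_group_set : group_set inertia.
Proof.
apply/group_setP; split.
  rewrite inE; apply/asboolP; exists id; split=> //.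
    by exists id.
  by move=> v n w /=; rewrite ag1.
move=> g h; rewrite [g \in _]finset.in_set [h \in _]finset.in_set [(g * h)%g \in _]finset.in_set.
move=> /asboolP[f [fl fb fm]] /asboolP[k [kl kb km]].
apply/asboolP; exists (k \o f); split.
- by move=> a x y /=; rewrite fl kl.
- exact: bij_comp.
- move=> v n w /=; rewrite ag_mul.
  by have /= -> := fm (rho h v) n w; have /= -> := km v n (f w).
Qed.
Canonical inertia_group := Group inertia_group_set.

Definition inertia_type : finGroupType := subg_of inertia_group.

(* Invertibility of phi(g) turns phi(g) Y_M(v, z) phi(g)^-1 = Y_M(g v, z)
   into the last-but-one field. *)
Record proj_action := ProjAction {
  pa_fun :> inertia_type -> M -> M;
  pa_linear : forall g, linear (pa_fun g);
  pa_bij : forall g, bijective (pa_fun g);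
  pa_conj : forall g v n w,
    pa_fun g (mmode v n w) = mmode (rho (sgval g) v) n (pa_fun g w);
  pa_1 : forall w, pa_fun 1%g w = w
}.

End Inertia.

Section LinearFacts.
Variables (R : realType) (U W : lmodType R[i]) (f : U -> W).
Hypothesis lf : linear f.

Let F : {linear U -> W} := HB.pack f (GRing.isLinear.Build _ _ _ _ f lf).

Lemma lin0 : f 0 = 0. Proof. exact: (linear0 F). Qed.
Lemma linB x y : f (x - y) = f x - f y. Proof. exact: (linearB F). Qed.
Lemma linZ c x : f (c *: x) = c *: f x. Proof. by rewrite -[LHS]/(F _) linearZ. Qed.
Lemma lin_sum (I : Type) (r : seq I) (P : pred I) (E : I -> U) :
  f (\sum_(i <- r | P i) E i) = \sum_(i <- r | P i) f (E i).
Proof. exact: (linear_sum F). Qed.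

End LinearFacts.

Section Schur.
Variables (R : realType) (V : vertex_data R) (M : module_data V).
Implicit Types (T : M -> M) (p q : {poly R[i]}).

Lemma poly_annihilates_eigen T :
  linear T -> forall p (w : M), p != 0 -> w != 0 ->
  \sum_(i < size p) p`_i *: iter i T w = 0 ->
  exists z, exists2 u, u != 0 & T u = z *: u.
Proof.
move=> lT p w p0.
pose ev q x := \sum_(i < size q) q`_i *: iter i T x.
have evE q n x : (size q <= n)%N -> ev q x = \sum_(i < n) q`_i *: iter i T x.
  move=> sq; rewrite /ev (big_ord_widen _ (fun i => q`_i *: iter i T x) sq).
  rewrite big_mkcond /=; apply: eq_bigr => i _; case: ifP => // /negbT.
  by rewrite -leqNgt => si; rewrite nth_default // scale0r.
have evM q z x : ev (q * ('X - z%:P)) x = ev q (T x - z *: x).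
  have itB i y : iter i T (T y - z *: y) = iter i.+1 T y - z *: iter i T y.
    by elim: i => //= i ->; rewrite (linB lT) (linZ lT).
  rewrite (@evE _ (size q).+1); last first.
    by have := size_polyMleq q ('X - z%:P); rewrite size_XsubC addn2.
  rewrite /ev; under [RHS]eq_bigr do rewrite itB scalerBr scalerA.
  rewrite sumrB.
  under eq_bigr do rewrite mulrBr coefB coefMX coefMC scalerBl.
  rewrite sumrB; congr (_ - _).
    by rewrite big_ord_recl /= scale0r add0r.
  by rewrite big_ord_recr /= nth_default // mul0r scale0r addr0.
have [rs] := closed_field_poly_normal p; move: (p) p0 => {}p p0 pE.
rewrite -/(ev p w) pE => w0.
have lc0 : lead_coef p != 0 by rewrite lead_coef_eq0.
have -> : lead_coef p *: \prod_(z <- rs) ('X - z%:P) =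
  (lead_coef p)%:P * \prod_(z <- rs) ('X - z%:P) by rewrite mul_polyC.
elim: rs w w0 {pE} => [|z rs IH] w w0.
  rewrite big_nil mulr1 (@evE _ 1) ?size_polyC ?leq_b1 // big_ord1 coefC /=.
  by move/eqP; rewrite scaler_eq0 (negPf lc0) (negPf w0).
rewrite big_cons mulrCA mulrC evM.
have [/eqP|/IH//] := eqVneq (T w - z *: w) 0.
by rewrite subr_eq0 => /eqP Tw _; exists z, w.
Qed.

Lemma schur T : irreducible_module M -> linear T ->
  (forall v n w, T (mmode v n w) = mmode v n (T w)) ->
  exists c, forall w, T w = c *: w.
Proof.
move=> [hM [w w0] simM] lT comT.
have wkM := module_weak hM.
have [a [x x0 xa]] : exists a, exists2 x, x != 0 & eigenspace_of (@mL _ _ M 0) a x.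
  have : (setT : set M) w by [].
  rewrite -(module_graded hM) => -[s [sE wE]].
  have [y ys y0] : exists2 y, y \in s & y != 0.
    apply: contrapT => ns; move: w0; rewrite wE big_seq big1 ?eqxx // => y ys.
    by apply/eqP/negPn/negP => y0; apply: ns; exists y.
  by have [_ [a _ <-] ya] := sE _ ys; exists a, y.
have ita i : eigenspace_of (@mL _ _ M 0) a (iter i T x).
  elim: i => //= i IH; rewrite /eigenspace_of /= /mL -comT -/(mL 0 _) IH.
  by rewrite (linZ lT).
have [n [b bP]] := module_fin_dim hM a.
have [c cE] : exists c : 'I_n.+1 -> 'I_n -> R[i],
    forall i : 'I_n.+1, iter i T x = \sum_(j < n) c i j *: b j.
  exists (fun i => projT1 (cid (bP _ (ita i)))) => i.
  exact: projT2 (cid (bP _ (ita i))).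
pose A : 'M[R[i]]_(n.+1, n) := \matrix_(i, j) c i j.
have : kermx A != 0.
  rewrite kermx_eq0 /row_free; apply/negP => /eqP rA.
  by have := rank_leq_col A; rewrite rA ltnn.
move=> /rowV0Pn[r /sub_kermxP rA r0].
have : exists z, exists2 u, u != 0 & T u = z *: u.
  pose p : {poly R[i]} := rVpoly r.
  have p0 : p != 0.
    by apply: contra r0 => /eqP p0; rewrite -[r]rVpolyK -/p p0 linear0.
  apply: (poly_annihilates_eigen lT p0 x0).
  have sp : (size p <= n.+1)%N by exact: size_poly.
  rewrite (big_ord_widen _ (fun i => p`_i *: iter i T x) sp).
  rewrite big_mkcond /=.
  rewrite (eq_bigr (fun i : 'I_n.+1 => \sum_(j < n) (r 0 i * c i j) *: b j)).
    rewrite exchange_big big1 //= => j _; rewrite -scaler_suml.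
    have /matrixP/(_ 0 j) := rA; rewrite !mxE.
    by under eq_bigr do rewrite mxE; move=> ->; rewrite scale0r.
  move=> i _; case: ifP => [_|/negbT].
    rewrite coef_rVpoly_ord cE scaler_sumr.
    by apply: eq_bigr => j _; rewrite scalerA.
  rewrite -leqNgt => spi; have := coef_rVpoly_ord r i.
  rewrite -/p nth_default // => <-.
  by rewrite big1 // => j _; rewrite mul0r scale0r.
move=> [z [u u0 Tu]]; exists z.
have := simM [set y | T y = z *: y]; case.
- split; first split=> /=.
  + by rewrite (lin0 lT) scaler0.
  + by move=> d y y' /= Ty Ty'; rewrite lT Ty Ty' scalerDr !scalerA mulrC.
  + move=> v m y /= Ty; rewrite comT Ty.
    by rewrite (linZ (mmode_linearr wkM v m)).
- by move=> E; have : [set y | T y = z *: y] u by []; rewrite E /= => /eqP; rewrite (negPf u0).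
- by move=> E y; have : (setT : set M) y by []; rewrite -E.
Qed.

End Schur.

Record cocycle (R : realType) (H : finGroupType) := Cocycle {
  cocycle_fun :> H -> H -> R[i];
  cocycle_neq0 : forall x y, cocycle_fun x y != 0;
  cocycleP : forall x y z, cocycle_fun x y * cocycle_fun (x * y)%g z =
                           cocycle_fun x (y * z)%g * cocycle_fun y z;
  cocycle1l : forall x, cocycle_fun 1%g x = 1;
  cocycle1r : forall x, cocycle_fun x 1%g = 1
}.

Section SchurCocycle.
Variables (R : realType) (V : voa R) (G : finGroupType) (rho : aut_group V G).
Variables (M : irr_module V) (phi : proj_action rho M).
Local Notation H := (inertia_type rho M).

(* The scalar, unique since M is nonzero, with
   phi(g) phi(h) = alpha(g, h) phi(gh). *)
Definition alpha (g h : H) : R[i] :=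
  xget 0 [set c | forall w, phi g (phi h w) = c *: phi (g * h)%g w].

Lemma alphaE g h w : phi g (phi h w) = alpha g h *: phi (g * h)%g w.
Proof.
suff : exists c, forall w, phi g (phi h w) = c *: phi (g * h)%g w.
  by move=> /(@xgetPex _ 0)/(_ w).
have [psi psiK Kpsi] := pa_bij phi (g * h)%g.
have lgh := pa_linear phi (g * h)%g.
have psil : linear psi.
  by move=> a x y; apply: (can_inj psiK); rewrite Kpsi lgh !Kpsi.
have psim v n x : psi (mmode (rho (sgval (g * h)%g) v) n x) = mmode v n (psi x).
  by apply: (can_inj psiK); rewrite Kpsi pa_conj Kpsi.
have [|v n x|c cE] := @schur _ _ M (psi \o (phi g \o phi h)) (irrP M).
- by move=> a x y /=; rewrite (pa_linear phi h) (pa_linear phi g) psil.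
- by rewrite /= (pa_conj phi h) (pa_conj phi g) -ag_mul -psim morphM ?inE.
- exists c => x; apply: (can_inj Kpsi); rewrite -/((psi \o (phi g \o phi h)) x).
  by rewrite cE (linZ psil) psiK.
Qed.

Let M_neq0 : exists w : M, w != 0. Proof. by have [] := irrP M. Qed.

Let phi_neq0 g (w : M) : w != 0 -> phi g w != 0.
Proof.
apply: contra => /eqP gw; apply/eqP/(bij_inj (pa_bij phi g)).
by rewrite gw (lin0 (pa_linear phi g)).
Qed.

Let scaler_eq (c d : R[i]) (w : M) : w != 0 -> c *: w = d *: w -> c = d.
Proof.
move=> w0 /eqP; rewrite -subr_eq0 -scalerBl scaler_eq0 (negPf w0) orbF.
by rewrite subr_eq0 => /eqP.
Qed.

Let alpha_neq0 g h : alpha g h != 0.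
Proof.
have [w w0] := M_neq0; apply/eqP => a0.
by have := phi_neq0 g (phi_neq0 h w0); rewrite alphaE a0 scale0r eqxx.
Qed.

Let alphaP x y z :
  alpha x y * alpha (x * y)%g z = alpha x (y * z)%g * alpha y z.
Proof.
have [w w0] := M_neq0; apply: (scaler_eq (phi_neq0 (x * y * z)%g w0)).
transitivity (phi x (phi y (phi z w))).
  by rewrite (alphaE x y) (alphaE (x * y)%g z) scalerA.
by rewrite (alphaE y z) (linZ (pa_linear phi x)) alphaE scalerA mulgA mulrC.
Qed.

Let alpha1l x : alpha 1%g x = 1.
Proof.
have [w w0] := M_neq0; apply: (scaler_eq (phi_neq0 x w0)).
by have := alphaE 1%g x w; rewrite pa_1 mul1g scale1r.
Qed.

Let alpha1r x : alpha x 1%g = 1.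
Proof.
have [w w0] := M_neq0; apply: (scaler_eq (phi_neq0 x w0)).
by have := alphaE x 1%g w; rewrite pa_1 mulg1 scale1r.
Qed.

Definition alpha_cocycle : cocycle R H :=
  Cocycle alpha_neq0 alphaP alpha1l alpha1r.

End SchurCocycle.

(* Functions on H, f standing for \sum_x f x bar x; the cocycle a is a phantom
   parameter on which the product depends. *)
Definition tga (R : realType) (H : finGroupType) (a : cocycle R H) : Type :=
  {ffun H -> R[i]^o}.

Section TwistedGroupAlgebra.
Variables (R : realType) (H : finGroupType) (a : cocycle R H).

HB.instance Definition _ := GRing.Lmodule.copy (tga a) {ffun H -> R[i]^o}.

Definition tga_basis (x : H) : tga a := [ffun y => (y == x)%:R].

(* The bilinear extension of bar x * bar y = a(x, y) bar(xy), cf. tga_basisM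
   below. *)
Definition tga_mul (f g : tga a) : tga a :=
  [ffun x => \sum_y f y * g (y^-1 * x)%g * a y (y^-1 * x)%g].

Let mulA : associative tga_mul.
Proof.
move=> f g h; apply/ffunP => x; rewrite !ffunE.
under [RHS]eq_bigr do rewrite ffunE 2!mulr_suml.
rewrite [RHS]exchange_big /=; apply: eq_bigr => y _.
rewrite ffunE mulr_sumr mulr_suml [RHS](reindex_inj (mulgI y)) /=.
apply: eq_bigr => t _; rewrite mulKg invMg -!mulgA.
have := cocycleP a y t (t^-1 * (y^-1 * x))%g; rewrite mulKVg => E.
rewrite -[RHS]mulrA -[_ * a y t * _]mulrA [a y t * _]mulrC.
rewrite -!mulrA; congr (_ * (_ * _)); rewrite !mulrA.
rewrite -[RHS]mulrA; rewrite -mulrA; congr (_ * _).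
by rewrite [RHS]mulrC E mulrC.
Qed.

Let mul1 : left_id (tga_basis 1%g) tga_mul.
Proof.
move=> f; apply/ffunP => x; rewrite ffunE (bigD1 1%g) //= big1 ?addr0.
  by rewrite ffunE eqxx mul1r invg1 mul1g cocycle1l mulr1.
by move=> y /negPf y1; rewrite ffunE y1 !mul0r.
Qed.

Let mulr1' : right_id (tga_basis 1%g) tga_mul.
Proof.
move=> f; apply/ffunP => x; rewrite ffunE (bigD1 x) //= big1 ?addr0.
  by rewrite ffunE mulVg eqxx mulr1 cocycle1r mulr1.
move=> y yx; rewrite ffunE -[_ == _](inj_eq (mulgI y)) mulKVg mulg1.
by rewrite eq_sym (negPf yx) mulr0 mul0r.
Qed.

Let mulDl : left_distributive tga_mul +%R.
Proof.
move=> f g h; apply/ffunP => x; rewrite !ffunE -big_split /=.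
by apply: eq_bigr => y _; rewrite ffunE !mulrDl.
Qed.

Let mulDr : right_distributive tga_mul +%R.
Proof.
move=> f g h; apply/ffunP => x; rewrite !ffunE -big_split /=.
by apply: eq_bigr => y _; rewrite ffunE mulrDr mulrDl.
Qed.

Let one_neq0 : tga_basis 1%g != 0.
Proof.
apply/eqP => /ffunP/(_ 1%g); rewrite !ffunE eqxx; apply/eqP.
exact: oner_neq0.
Qed.

HB.instance Definition _ := GRing.Zmodule_isNzRing.Build (tga a)
  mulA mul1 mulr1' mulDl mulDr one_neq0.

Let scaleAl (c : R[i]) (f g : tga a) : c *: (f * g) = (c *: f) * g.
Proof.
apply/ffunP => x; rewrite !ffunE scaler_sumr; apply: eq_bigr => y _.
by rewrite !ffunE /GRing.scale /= !mulrA.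
Qed.

HB.instance Definition _ := GRing.Lmodule_isLalgebra.Build R[i] (tga a) scaleAl.

Let scaleAr (c : R[i]) (f g : tga a) : c *: (f * g) = f * (c *: g).
Proof.
apply/ffunP => x; rewrite !ffunE scaler_sumr; apply: eq_bigr => y _.
by rewrite !ffunE /GRing.scale /= !mulrA [c * _]mulrC.
Qed.

HB.instance Definition _ := GRing.Lalgebra_isAlgebra.Build R[i] (tga a) scaleAr.

Lemma tga_basisM x y :
  tga_basis x * tga_basis y = a x y *: tga_basis (x * y)%g.
Proof.
apply/ffunP => z; rewrite !ffunE (bigD1 x) //= big1 ?addr0; last first.
  by move=> t /negPf tx; rewrite ffunE tx !mul0r.
rewrite !ffunE eqxx mul1r -[_ == y](inj_eq (mulgI x)) mulKVg.
rewrite /GRing.scale /= mulrC; case: eqP => [->|_]; first by rewrite mulKg.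
by rewrite !mulr0.
Qed.

Lemma tga_basis_sum (f : tga a) : f = \sum_x f x *: tga_basis x.
Proof.
apply/ffunP => y; rewrite sum_ffunE (bigD1 y) //= big1 ?addr0 => [|x xy].
  by rewrite !ffunE eqxx /GRing.scale /= mulr1.
by rewrite !ffunE eq_sym (negPf xy) scaler0.
Qed.

End TwistedGroupAlgebra.

Section AlgebraModules.
Variables (R : realType) (A : algType R[i]).

Record alg_action (W : lmodType R[i]) := AlgAction {
  act :> A -> W -> W;
  act_linearl : forall w, linear (act^~ w);
  act_linearr : forall a, linear (act a);
  act_1 : forall w, act 1 w = w;
  act_M : forall a b w, act (a * b) w = act a (act b w)
}.

Definition alg_submodule (W : lmodType R[i]) (actW : alg_action W)
    (N : set W) : Prop :=
  is_subspace N /\ forall a w, N w -> N (actW a w).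

Definition alg_hom (W U : lmodType R[i]) (actW : alg_action W)
    (actU : alg_action U) (f : W -> U) : Prop :=
  linear f /\ forall a w, f (actW a w) = actU a (f w).

Record fd_module := FdModule {
  fd_car :> vectType R[i];
  fd_act : alg_action fd_car
}.

Definition simple_module (W : fd_module) : Prop :=
  (exists w : W, w != 0) /\
  forall N : set W, alg_submodule (fd_act W) N -> N = [set 0] \/ N = setT.

Definition trace (W : vectType R[i]) (f : W -> W) : R[i] :=
  \sum_(i < \dim {:W}) coord (vbasis {:W}) i (f (vbasis {:W})`_i).

Definition character (W : fd_module) : A -> R[i] :=
  fun a => trace (fd_act W a).

(* When A is finite dimensional, so is every simple A-module. *)
Definition irr_characters : set (A -> R[i]) :=
  [set chi | exists2 W : fd_module, simple_module W & character W = chi].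

Section Isotypic.
Variables (W : fd_module) (M : lmodType R[i]) (actM : alg_action M).

(* The sum of all submodules of M isomorphic to W. *)
Definition isotypic : set M := sum_subspaces
  [set N | alg_submodule actM N /\
    exists f : W -> M, [/\ alg_hom (fd_act W) actM f, injective f & range f = N]].

Definition hom_pred : {pred W -> M} :=
  fun f => `[< alg_hom (fd_act W) actM f >].

Lemma hom_pred_closed : GRing.subsemimod_closed hom_pred.
Proof.
have lM := act_linearr actM; split; first split.
- apply/asboolP; split; first by move=> c x y; rewrite /= scaler0 addr0.
  by move=> a w; rewrite [RHS](lin0 (lM a)).
- move=> f g /asboolP[lf fa] /asboolP[lg ga]; apply/asboolP; split.
    move=> c x y; rewrite -![(f + g) _]/(f _ + g _) lf lg scalerDr.
    by rewrite addrACA.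
  move=> a w; rewrite -![(f + g) _]/(f _ + g _) fa ga.
  by have := lM a 1 (f w) (g w); rewrite !scale1r.
- move=> c f /asboolP[lf fa]; apply/asboolP; split.
    move=> d x y; rewrite -![(c *: f) _]/(c *: f _) lf scalerDr !scalerA.
    by rewrite mulrC.
  move=> a w; rewrite -![(c *: f) _]/(c *: f _) fa.
  by rewrite (linZ (lM a)).
Qed.

Record hom_space := HomSpace { hom_val :> W -> M; _ : hom_val \in hom_pred }.
HB.instance Definition _ := [isSub for hom_val].
HB.instance Definition _ := [Choice of hom_space by <:].
HB.instance Definition _ := GRing.SubChoice_isSubLmodule.Build
  R[i] (W -> M) hom_pred hom_space hom_pred_closed.

End Isotypic.

End AlgebraModules.
Arguments irr_characters {R} A _.
Arguments hom_pred {R A} W {M} actM.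
Arguments hom_space {R A} W {M} actM.
Arguments isotypic {R A} W {M} actM.

Section FixedPoints.
Variables (R : realType) (V : voa R) (G : finGroupType) (rho : aut_group V G).

Definition fixed_pred : {pred V} := fun v => `[< forall g, rho g v = v >].

Lemma fixed_predP v : reflect (forall g, rho g v = v) (v \in fixed_pred).
Proof. exact: asboolP. Qed.

Let ag_linear g : linear (rho g). Proof. by have [] := ag_aut rho g. Qed.

Lemma fixed_pred_closed : GRing.subsemimod_closed fixed_pred.
Proof.
split; first split.
- by apply/fixed_predP => g; rewrite (lin0 (ag_linear g)).
- move=> u v /fixed_predP fu /fixed_predP fv; apply/fixed_predP => g.
  by have := ag_linear g 1 u v; rewrite !scale1r fu fv.
- move=> c u /fixed_predP fu; apply/fixed_predP => g.
  by rewrite (linZ (ag_linear g)) fu.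
Qed.

Record fixed_space := FixedSpace { fixed_val :> V; _ : fixed_val \in fixed_pred }.
HB.instance Definition _ := [isSub for fixed_val].
HB.instance Definition _ := [Choice of fixed_space by <:].
HB.instance Definition _ := GRing.SubChoice_isSubLmodule.Build
  R[i] V fixed_pred fixed_space fixed_pred_closed.

Lemma fixed_valP (v : fixed_space) g : rho g (fixed_val v) = fixed_val v.
Proof. by case: v => v /= /fixed_predP. Qed.

Lemma fixed_mode_subproof (u v : fixed_space) n :
  mode (fixed_val u) n (fixed_val v) \in fixed_pred.
Proof.
apply/fixed_predP => g; have [_ _ _ _ gm] := ag_aut rho g.
by rewrite gm !fixed_valP.
Qed.

Lemma fixed_vacuum_subproof : vacuum V \in fixed_pred.
Proof. by apply/fixed_predP => g; have [] := ag_aut rho g. Qed.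

Lemma fixed_conformal_subproof : conformal V \in fixed_pred.
Proof. by apply/fixed_predP => g; have [] := ag_aut rho g. Qed.

Definition fixed_data : vertex_data R := @VertexData R fixed_space
  (fun u n v => FixedSpace (fixed_mode_subproof u v n))
  (FixedSpace fixed_vacuum_subproof) (FixedSpace fixed_conformal_subproof).

Local Notation VG := fixed_data.
Let fval (v : VG) : V := fixed_val v.

Let fval_inj : injective fval. Proof. exact: val_inj. Qed.
Let fvalD : {morph fval : u v / u + v}. Proof. by []. Qed.
Let fvalN : {morph fval : u / - u}. Proof. by []. Qed.
Let fvalZ c : {morph fval : u / c *: u}. Proof. by []. Qed.
Let fval0 : fval 0 = 0. Proof. by []. Qed.
Let fvalM u n v : fval (mode u n v) = mode (fval u) n (fval v). Proof. by []. Qed.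

Let fval_sum (I : Type) (r : seq I) (E : I -> VG) :
  fval (\sum_(i <- r) E i) = \sum_(i <- r) fval (E i).
Proof. by elim/big_rec2: _ => // i y x _ <-. Qed.

Let fval_fsum (E : nat -> VG) :
  fval (\sum_(i \in [set: nat]) E i) = \sum_(i \in [set: nat]) fval (E i).
Proof.
rewrite fval_sum; suff -> : finite_support 0 [set: nat] E =
  finite_support 0 [set: nat] (fun i => fval (E i)) by [].
have suppE : E @^-1` [set~ 0] = (fun i => fval (E i)) @^-1` [set~ 0].
  by apply/seteqP; split=> i /= Ei E0; apply: Ei; [exact: fval_inj | rewrite E0].
by rewrite /finite_support !unlock suppE.
Qed.

Let avg (v : V) : V := (#|G|%:R)^-1 *: \sum_g rho g v.

Let avg_fixed v : avg v \in fixed_pred.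
Proof.
apply/fixed_predP => h; rewrite (linZ (ag_linear h)) (lin_sum (ag_linear h)).
congr (_ *: _); rewrite [RHS](reindex_inj (mulgI h)) /=.
by apply: eq_bigr => g _; rewrite ag_mul.
Qed.

Let avg_linear : linear avg.
Proof.
move=> c u v; rewrite /avg; under eq_bigr do rewrite ag_linear.
by rewrite big_split /= -scaler_sumr scalerDr !scalerA [c * _]mulrC.
Qed.

Let avg_id (v : VG) : avg (fval v) = fval v.
Proof.
rewrite /avg; under eq_bigr do rewrite fixed_valP.
rewrite sumr_const. rewrite -(scaler_nat _ (fval v)). rewrite scalerA mulVf ?scale1r //.
by rewrite pnatr_eq0 -lt0n; apply/card_gt0P; exists 1%g.
Qed.

Let AVG (v : V) : VG := FixedSpace (avg_fixed v).
Let fvalAVG v : fval (AVG v) = avg v. Proof. by []. Qed.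

Let avg_vL (v : V) : avg (vL 0 v) = vL 0 (avg v).
Proof.
have l0 : linear (vL 0 : V -> V) by exact: (mode_linearr (voaP V)).
rewrite /avg (linZ l0) (lin_sum l0); congr (_ *: _).
apply: eq_bigr => g _; rewrite /vL; have [_ _ _ gc gm] := ag_aut rho g.
by rewrite gm gc.
Qed.

Let fval_eigen n (v : VG) : eigenspace_of (vL 0) n v <-> eigenspace_of (vL 0) n (fval v).
Proof.
by split=> [E|E]; [rewrite /eigenspace_of /= -fvalZ -E | apply: fval_inj].
Qed.

Lemma fixed_is_voa : is_voa fixed_data.
Proof.
have vV := voaP V; split.
- by move=> n w c x y; apply: fval_inj; exact: (mode_linearl vV).
- by move=> u n c x y; apply: fval_inj; exact: (mode_linearr vV).
- move=> u w; have [N NP] := mode_truncation vV (fval u) (fval w).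
  by exists N => n Nn; apply: fval_inj; exact: NP.
- move=> n w; apply: fval_inj; rewrite fvalM (mode_vacuum vV).
  by case: ifP.
- by move=> u; apply: fval_inj; exact: (mode_creation vV).
- by move=> u n n0; apply: fval_inj; exact: (mode_creation0 vV).
- move=> u v w l m n; apply: fval_inj.
  rewrite fvalD fvalN fvalZ !fval_fsum.
  exact: (mode_jacobi vV (fval u) (fval v) (fval w) l m n).
- have [c cP] := virasoro vV; exists c => m n w.
  by apply: fval_inj; exact: (cP m n (fval w)).
- by move=> u n w; apply: fval_inj; exact: (vL_derivative vV).
- apply/seteqP; split=> // v _.
  have : (setT : set V) (fval v) by [].
  rewrite -(voa_graded vV) => -[s [sP vE]].
  exists [seq AVG x | x <- s]; split=> [y /mapP[x xs ->]|].
    have [N [n _ <-] Nx] := sP _ xs.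
    exists (eigenspace_of (vL 0) n%:~R); first by exists n.
    apply/fval_eigen; rewrite fvalAVG /eigenspace_of /= -avg_vL Nx.
    by rewrite (linZ avg_linear).
  apply: fval_inj; rewrite fval_sum big_map -avg_id vE.
  by rewrite (lin_sum avg_linear).
- move=> n; have [k [b bP]] := voa_fin_dim vV n.
  exists k, (fun i => AVG (b i)) => x /fval_eigen/bP[c xE]; exists c.
  apply: fval_inj; rewrite fval_sum -avg_id xE (lin_sum avg_linear).
  by apply: eq_bigr => i _; rewrite (linZ avg_linear).
- have [N NP] := voa_bounded vV; exists N => n nN; apply/seteqP; split=> x /=.
    move/fval_eigen; rewrite NP //= => x0.
    exact: fval_inj.
  by move=> ->; apply/fval_eigen; rewrite fval0 NP.
- by apply: fval_inj; exact: (vacuum_weight vV).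
- by apply: fval_inj; exact: (conformal_weight vV).
Qed.

Definition fixed_voa : voa R := Voa fixed_is_voa.

End FixedPoints.

Section DualPair.
Variables (R : realType) (V : voa R) (G : finGroupType) (rho : aut_group V G).
Variables (M : irr_module V) (phi : proj_action rho M).
Local Notation H := (inertia_type rho M).
Local Notation A := (tga (alpha_cocycle phi)).

Definition tga_act (a : A) (w : M) : M := \sum_g a g *: phi g w.

Lemma tga_act_basis g w : tga_act (tga_basis _ g) w = phi g w.
Proof.
rewrite /tga_act (bigD1 g) //= big1 ?addr0 => [|h /negPf hg].
  by rewrite ffunE eqxx scale1r.
by rewrite ffunE hg scale0r.
Qed.

Let tga_act_linearl w : linear (tga_act^~ w).
Proof.
move=> c a b; rewrite /tga_act scaler_sumr -big_split /=.
by apply: eq_bigr => g _; rewrite !ffunE scalerDl scalerA.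
Qed.

Let tga_act_linearr a : linear (tga_act a).
Proof.
move=> c w x; rewrite /tga_act scaler_sumr -big_split /=.
apply: eq_bigr => g _; rewrite (pa_linear phi g) scalerDr !scalerA.
by rewrite mulrC.
Qed.

Let tga_act_1 w : tga_act 1 w = w.
Proof. by rewrite (tga_act_basis 1%g w) pa_1. Qed.

Let tga_act_M a b w : tga_act (a * b) w = tga_act a (tga_act b w).
Proof.
rewrite /tga_act; under eq_bigr do rewrite ffunE scaler_suml.
rewrite exchange_big /=; apply: eq_bigr => g _.
rewrite (lin_sum (pa_linear phi g)) scaler_sumr (reindex_inj (mulgI g)) /=.
apply: eq_bigr => h _; rewrite mulKg (linZ (pa_linear phi g)) alphaE.
by rewrite !scalerA.
Qed.

Definition tga_action : alg_action A M :=
  AlgAction tga_act_linearl tga_act_linearr tga_act_1 tga_act_M.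

Section Multiplicity.
Variable W : fd_module A.

Lemma mult_mode_subproof (v : fixed_voa rho) n (f : hom_space W tga_action) :
  (fun w => mmode (fixed_val v) n (f w)) \in hom_pred W tga_action.
Proof.
have lM := mmode_linearr (module_weak (let: And3 h _ _ := irrP M in h)).
case: f => f /= /asboolP[lf fa]; apply/asboolP; split.
  by move=> c x y; rewrite lf lM.
move=> a w; rewrite fa /= /tga_act (lin_sum (lM _ _)); apply: eq_bigr => g _.
by rewrite (linZ (lM _ _)) pa_conj fixed_valP.
Qed.

(* The multiplicity space Hom_A(W, M), with V^G acting through M. *)
Definition mult_module : module_data (fixed_voa rho) :=
  @ModuleData R (fixed_voa rho) (hom_space W tga_action)
    (fun v n f => HomSpace (mult_mode_subproof v n f)).

End Multiplicity.

End DualPair.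
Arguments mult_module {R V G rho M} phi W.

(* Main.v *)
(* Jacobson-density argument.  For x in a finite direct sum X of twists M o g
   (g in G), the span of all v_n x is already a V-submodule, by associativity;
   X is semisimple, and its homomorphisms between summands are scalar multiples
   of the phi(k), k in G_M, by Schur's lemma.  Taking x and y constant along G
   and averaging over G shows: if every A-linear relation, A = C^alpha[G_M],
   between w_1, ..., w_k in M also holds between z_1, ..., z_k, then a single
   combination of modes of V^G maps each w_j to z_j.  Applied to the images of
   a basis of W_lambda (and of W_gamma) in M, this gives 2) and 3).  For 1),
   simplicity of V and faithfulness of G make the phi(g) linearly independent,
   and A is a Frobenius algebra.  *)

Require Import Defs.
From mathcomp Require Import all_boot all_order all_algebra all_fingroup.
From mathcomp Require Import complex.
From mathcomp Require Import boolp classical_sets functions.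
From mathcomp Require Import reals.
From mathcomp Require Import fsbigop.

Set Implicit Arguments.
Unset Strict Implicit.
Unset Printing Implicit Defensive.

Import Order.TTheory GRing.Theory Num.Theory.

Local Open Scope classical_set_scope.
Local Open Scope ring_scope.

(** * Finite sums, subspaces and binomial coefficients *)

Lemma fsum_nat_trunc (U : nmodType) (F : nat -> U) (N : nat) :
  (forall i, (N <= i)%N -> F i = 0) ->
  \sum_(i \in [set: nat]) F i = \sum_(i < N) F i.
Proof.
move=> F0; rewrite fsbig_ord; symmetry; apply: fsbig_widen => //.
by move=> i [_ /negP]; rewrite -leqNgt => /F0.
Qed.

(** Truncation bounds depend on the vector; one common bound lets Jacobi identities over a finite
    family be added term by term. *)
Lemma uniform_bound (I : finType) (P : I -> nat -> Prop) :
  (forall i, exists N : nat, forall k, (N <= k)%N -> P i k) ->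
  exists N : nat, forall i k, (N <= k)%N -> P i k.
Proof.
move=> /choice[N NP]; exists (\max_i N i) => i k Nk; apply: NP.
exact: leq_trans (leq_bigmax i) Nk.
Qed.

Lemma linD (R : realType) (U W : lmodType R[i]) (f : U -> W) :
  linear f -> {morph f : x y / x + y}.
Proof. by move=> lf x y; have := lf 1 x y; rewrite !scale1r. Qed.

Section Subspaces.
Variables (R : realType) (U : lmodType R[i]) (N : set U).
Hypothesis sN : is_subspace N.

Lemma subspaceD x y : N x -> N y -> N (x + y).
Proof. by move=> Nx Ny; have := sN.2 1 _ _ Nx Ny; rewrite scale1r. Qed.

Lemma subspaceZ c x : N x -> N (c *: x).
Proof. by move=> Nx; have := sN.2 c _ _ Nx sN.1; rewrite addr0. Qed.

Lemma subspaceB x y : N x -> N y -> N (x - y).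
Proof. by move=> Nx Ny; rewrite -scaleN1r; apply/subspaceD/subspaceZ. Qed.

Lemma subspace_sum (I : eqType) (r : seq I) (P : pred I) (E : I -> U) :
  (forall i, i \in r -> P i -> N (E i)) -> N (\sum_(i <- r | P i) E i).
Proof.
move=> NE; rewrite big_seq_cond; apply: big_ind => [|x y|i /andP[]].
- exact: sN.1.
- exact: subspaceD.
- exact: NE.
Qed.

End Subspaces.

Section Binomials.
Variable R : realType.

Lemma gbinom0 (x : R[i]) : gbinom x 0 = 1.
Proof. by rewrite /gbinom big_ord0 fact0 divr1. Qed.

Lemma gbinom0l (n : nat) : gbinom (0 : R[i]) n.+1 = 0.
Proof. by rewrite /gbinom big_ord_recl subrr !mul0r. Qed.

End Binomials.

(** * Modes and the Jacobi identity *)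

Section VertexAlgebra.
Variables (R : realType) (V : voa R).
Implicit Types (u v w : V).

Lemma mode0l n w : mode (0 : V) n w = 0.
Proof. exact: (lin0 (mode_linearl (voaP V) n w)). Qed.

Lemma mode0r u n : mode u n (0 : V) = 0.
Proof. exact: (lin0 (mode_linearr (voaP V) u n)). Qed.

Lemma mode_trunc u (n : int) w :
  exists N : nat, forall i, (N <= i)%N -> mode u (n + i%:Z) w = 0.
Proof.
have [B BP] := mode_truncation (voaP V) u w.
exists `|B - n|%N => i Ni; apply: BP; rewrite -lerBlDl.
by rewrite (le_trans (ler_norm _)) // -abszE lez_nat.
Qed.

(** The Jacobi identity at l = 0, where each binomial expansion on the left reduces to its first
    term. *)
Lemma mode_commutator u v w (m n : int) (N : nat) :
  (forall i, (N <= i)%N -> mode u i%:Z v = 0) ->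
  mode u m (mode v n w) - mode v n (mode u m w) =
  \sum_(i < N) gbinom (m%:~R : R[i]) i *: mode (mode u i%:Z v) (m + n - i%:Z) w.
Proof.
move=> uv0; have := mode_jacobi (voaP V) u v w 0 m n.
have gb0 (F : nat -> V) : \sum_(i \in [set: nat])
    ((-1) ^+ i * gbinom ((0 : int)%:~R : R[i]) i) *: F i = F 0%N.
  rewrite (@fsum_nat_trunc _ _ 1) => [|[|i] // _].
    by rewrite big_ord1 expr0 gbinom0 mulr1 scale1r.
  by rewrite gbinom0l mulr0 scale0r.
rewrite !gb0 expr0z scale1r !addr0 => ->.
rewrite (@fsum_nat_trunc _ _ N) => [|i Ni].
  by apply: eq_bigr => i _; rewrite add0r.
by rewrite add0r uv0 // mode0l scaler0.
Qed.

(* Skew-symmetry, obtained by commuting two modes on the vacuum. *)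
Lemma left_ideal_ideal (J : set V) : is_subspace J ->
  (forall u n v, J v -> J (mode u n v)) -> is_ideal J.
Proof.
move=> sJ lJ; split=> // u v n Jv; split; first exact: lJ.
have Jvac w k : J w -> J (mode w k (vacuum V)).
  have [k0|] := leP 0 k; first by rewrite (mode_creation0 (voaP V)) // => _; exact: sJ.1.
  case: k => // k _; elim: k w => [|k IH] w Jw.
    by rewrite NegzE (mode_creation (voaP V)).
  (* L(-1) w = omega_0 w lies in J, and (L(-1) w)_(-k-1) 1 = (k + 1) w_(-k-2) 1. *)
  have := IH _ (lJ _ 0 _ Jw : J (vL (-1) w)).
  rewrite (vL_derivative (voaP V)).
  have -> : Negz k - 1 = Negz k.+1 by rewrite !NegzE -opprD -PoszD addn1.
  move=> /(subspaceZ sJ (- (Negz k)%:~R)^-1); rewrite scalerA mulVf ?scale1r //.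
  by rewrite oppr_eq0 intr_eq0.
have [N uvN] := mode_trunc u 0 v.
have := mode_commutator (vacuum V) (-1) n (N := N) (u := u) (v := v).
rewrite (mode_creation (voaP V)) => comm.
(* Since u = u_(-1) 1, the difference is a commutator, hence a sum of modes of the u_i v in J
   applied to the vacuum. *)
have -> : mode v n u = mode u (-1) (mode v n (vacuum V))
  - (mode u (-1) (mode v n (vacuum V)) - mode v n u).
  by rewrite opprB addrC subrK.
rewrite comm => [|i Ni]; last by rewrite -[i%:Z]add0r uvN.
apply: (subspaceB sJ); first exact/lJ/Jvac.
by apply: (subspace_sum sJ) => i _ _; apply/(subspaceZ sJ)/Jvac/lJ.
Qed.

End VertexAlgebra.

Section WeakModules.
Variables (R : realType) (V : voa R) (M : module_data V).
Hypothesis hM : is_weak_module M.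
Implicit Types (u v : V) (w : M).

Lemma mmode0l n w : mmode (0 : V) n w = 0.
Proof. exact: (lin0 (mmode_linearl hM n w)). Qed.

Lemma mmode0r u n : mmode u n (0 : M) = 0.
Proof. exact: (lin0 (mmode_linearr hM u n)). Qed.

Lemma mmode_trunc u (n : rat) w :
  exists N : nat, forall i, (N <= i)%N -> mmode u (n + i%:R) w = 0.
Proof.
have [B BP] := mmode_truncation hM u w.
exists (Num.bound `|B - n|) => i Ni; apply: BP; rewrite -lerBlDl.
rewrite (le_trans (ler_norm _)) // (le_trans (ltW (archi_boundP _))) //.
by rewrite ler_nat.
Qed.

(** The bounds are parameters so that instances for several vectors share their ranges; a bound 0
    removes a sum. *)
Lemma mmode_jacobi_trunc u v w (l : int) (m n : rat) (N1 N2 N3 : nat) :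
  (forall i, (N1 <= i)%N -> mmode v (n + i%:R) w = 0) ->
  (forall i, (N2 <= i)%N -> mmode u (m + i%:R) w = 0) ->
  (forall i, (N3 <= i)%N -> mode u (l + i%:Z) v = 0) ->
  (\sum_(i < N1) ((-1) ^+ i * gbinom (l%:~R : R[i]) i) *:
      mmode u (m + l%:~R - i%:R) (mmode v (n + i%:R) w))
  - (-1) ^ l *: (\sum_(i < N2) ((-1) ^+ i * gbinom (l%:~R : R[i]) i) *:
      mmode v (n + l%:~R - i%:R) (mmode u (m + i%:R) w))
  = if m \is a Num.int then
      \sum_(i < N3) gbinom (ratr m : R[i]) i *:
        mmode (mode u (l + i%:Z) v) (m + n - i%:R) w
    else 0.
Proof.
move=> h1 h2 h3; have := mmode_jacobi hM u v w l m n.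
rewrite (@fsum_nat_trunc _ _ N1) => [|i /h1->]; last by rewrite mmode0r scaler0.
rewrite (@fsum_nat_trunc _ _ N2) => [|i /h2->]; last by rewrite mmode0r scaler0.
rewrite (@fsum_nat_trunc _ _ N3) // => i /h3 ->.
by rewrite mmode0l scaler0.
Qed.

Lemma mmode_commute u v w (m n : rat) :
  (forall i : nat, mode u i%:Z v = 0) ->
  mmode u m (mmode v n w) = mmode v n (mmode u m w).
Proof.
move=> uv0; apply/eqP; rewrite -subr_eq0.
have [N1 h1] := mmode_trunc v n w; have [N2 h2] := mmode_trunc u m w.
have := @mmode_jacobi_trunc u v w 0 m n N1.+1 N2.+1 0.
rewrite !big_ord_recl big1 => [|i _]; last by rewrite gbinom0l mulr0 scale0r.
rewrite big1 => [|i _]; last by rewrite gbinom0l mulr0 scale0r.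
rewrite !big_ord0 /= gbinom0 expr0 expr0z !mulr1 !scale1r !addr0 => ->.
- by case: ifP.
- by move=> i /ltnW; exact: h1.
- by move=> i /ltnW; exact: h2.
- by move=> i _; rewrite add0r.
Qed.

(* V acts on X through the direct sum of the twists of M by the tau i. *)
Section Tuples.
Variables (I : finType) (tau : I -> V -> V).
Hypothesis tau_linear : forall i, linear (tau i).
Hypothesis tau_mode : forall i u n v,
  tau i (mode u n v) = mode (tau i u) n (tau i v).
Local Notation X := {ffun I -> M}.

Definition tuple_mode v (n : rat) (x : X) : X :=
  [ffun i => mmode (tau i v) n (x i)].

(** Scalars can be absorbed into v, so plain sums of modes already form a subspace. *)
Definition mode_span (x : X) : set X :=
  [set y | exists s : seq (V * rat), y = \sum_(p <- s) tuple_mode p.1 p.2 x].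

Lemma tuple_mode_linearl n x : linear (fun v => tuple_mode v n x).
Proof.
move=> c u v; apply/ffunP => i; rewrite !ffunE tau_linear.
exact: (mmode_linearl hM).
Qed.

Lemma tuple_mode_linearr v n : linear (tuple_mode v n).
Proof.
by move=> c x y; apply/ffunP => i; rewrite !ffunE; exact: (mmode_linearr hM).
Qed.

Lemma mode_span_mode x v n : mode_span x (tuple_mode v n x).
Proof. by exists [:: (v, n)]; rewrite big_seq1. Qed.

Lemma mode_span_subspace x : is_subspace (mode_span x).
Proof.
split; first by exists nil; rewrite big_nil.
move=> c _ _ [s ->] [t ->]; exists ([seq (c *: p.1, p.2) | p <- s] ++ t).
rewrite big_cat big_map /= scaler_sumr; congr (_ + _); apply: eq_bigr => p _.
by rewrite -(linZ (tuple_mode_linearl _ _)).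
Qed.

Lemma tuple_mode_trunc v (n : rat) x :
  exists N : nat, forall i, (N <= i)%N -> tuple_mode v (n + i%:R) x = 0.
Proof.
have [N NP] := uniform_bound (fun j : I => mmode_trunc (tau j v) n (x j)).
by exists N => i Ni; apply/ffunP => j; rewrite !ffunE NP.
Qed.

(** The second sum of the Jacobi identity drops out because u_(k+i) x = 0, and the right side
    consists of single modes of the u_(l+i) v. *)
Lemma tuple_mode_assoc u v (l : int) (k n : rat) (N : nat) x :
  (forall i : nat, tuple_mode u (k + i%:R) x = 0) ->
  (forall i, (N <= i)%N -> tuple_mode v (n + i%:R) x = 0) ->
  mode_span x (\sum_(i < N) ((-1) ^+ i * gbinom (l%:~R : R[i]) i) *:
      tuple_mode u (k + l%:~R - i%:R) (tuple_mode v (n + i%:R) x)).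
Proof.
move=> ux vx; have [N3 uv] := mode_trunc u l v.
pose rhs := if k \is a Num.int then
      \sum_(i < N3) gbinom (ratr k : R[i]) i *:
        tuple_mode (mode u (l + i%:Z) v) (k + n - i%:R) x
    else 0.
suff -> : \sum_(i < N) ((-1) ^+ i * gbinom (l%:~R : R[i]) i) *:
      tuple_mode u (k + l%:~R - i%:R) (tuple_mode v (n + i%:R) x) = rhs.
  rewrite /rhs; case: ifP => _; last exact: (mode_span_subspace x).1.
  apply: (subspace_sum (mode_span_subspace x)) => i _ _.
  exact/(subspaceZ (mode_span_subspace x))/mode_span_mode.
apply/ffunP => j.
have := @mmode_jacobi_trunc (tau j u) (tau j v) (x j) l k n N 0 N3.
rewrite big_ord0 scaler0 subr0 => E.
transitivity (if k \is a Num.int then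
      \sum_(i < N3) gbinom (ratr k : R[i]) i *:
        mmode (mode (tau j u) (l + i%:Z) (tau j v)) (k + n - i%:R) (x j)
    else 0).
- rewrite -E => [|i Ni|i _|i Ni].
  + by rewrite sum_ffunE; apply: eq_bigr => i _; rewrite !ffunE.
  + by have /ffunP/(_ j) := vx i Ni; rewrite !ffunE.
  + by have /ffunP/(_ j) := ux i; rewrite !ffunE.
  + by rewrite -tau_mode uv // (lin0 (tau_linear j)).
- rewrite /rhs; case: ifP => _; last by rewrite ffunE.
  by rewrite sum_ffunE; apply: eq_bigr => i _; rewrite !ffunE tau_mode.
Qed.

(* Associativity expresses u_m v_n x through (u_i v)_j x and the products
   u_(m-i) v_(n+i) x with i > 0; the latter vanish for n large. *)
Lemma mode_span_closed x u m y :
  mode_span x y -> mode_span x (tuple_mode u m y).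
Proof.
move=> [s ->]; rewrite (lin_sum (tuple_mode_linearr u m)).
apply: (subspace_sum (mode_span_subspace x)) => -[v n] _ _ /=.
have [d] := tuple_mode_trunc v n x.
elim: d m n => [|d IH] m n vx.
  have := vx 0%N isT; rewrite addr0 => ->.
  rewrite (lin0 (tuple_mode_linearr u m)).
  exact: (mode_span_subspace x).1.
have [N2 ux] := tuple_mode_trunc u m x.
(* With k = m + N2 all u_(k+i) x vanish, and l = -N2 makes the i = 0 term u_m v_n x. *)
have := @tuple_mode_assoc u v (- N2%:Z) (m + N2%:R) n d.+1 x.
rewrite big_ord_recl /= expr0 gbinom0 mulr1 scale1r addr0 subr0.
rewrite rmorphN /= addrK => /(_ _ vx) assoc.
have {}assoc := assoc (fun i => _); set S := \sum_(i < d) _ in assoc.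
rewrite -[tuple_mode u m _](addrK S); apply: (subspaceB (mode_span_subspace x)).
  by apply: assoc => i; rewrite -addrA -natrD; apply: ux; rewrite leq_addr.
apply: (subspace_sum (mode_span_subspace x)) => i _ _.
apply/(subspaceZ (mode_span_subspace x))/IH => k dk.
rewrite -addrA -natrD; apply: vx.
by rewrite /bump leq0n add1n addSn ltnS (leq_trans dk) // leq_addl.
Qed.

End Tuples.

End WeakModules.

(** * Density of the modes of the fixed points *)

Section Separation.
Variables (R : realType) (V : voa R) (M : module_data V).
Hypothesis irrM : irreducible_module M.
Variables (I : finType) (tau : I -> V -> V).
Hypothesis tau_surj : forall i v, exists u, tau i u = v.
Local Notation X := {ffun I -> M}.

Let hM : is_weak_module M. Proof. by have [/module_weak] := irrM. Qed.

Let delta (j : I) (m : M) : X := [ffun i => if i == j then m else 0].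

Let delta_linear j : linear (delta j).
Proof.
by move=> c x y; apply/ffunP => i; rewrite !ffunE; case: eqP; rewrite ?scaler0 ?addr0.
Qed.

Let delta_mode j v n m :
  tuple_mode tau v n (delta j m) = delta j (mmode (tau j v) n m).
Proof.
by apply/ffunP => i; rewrite !ffunE; case: eqP => [->|] //; rewrite mmode0r.
Qed.

Let delta_sum (x : X) : x = \sum_j delta j (x j).
Proof.
apply/ffunP => i; rewrite sum_ffunE (bigD1 i) //= ffunE eqxx big1 ?addr0 //.
by move=> j /negPf ji; rewrite ffunE eq_sym ji.
Qed.

(* A maximal set J of coordinates whose partial sum meets D trivially spans a
   complement of D; project along D onto a coordinate in J. *)
Lemma submodule_separation (D : set X) (y : X) :
  is_subspace D -> (forall v n x, D x -> D (tuple_mode tau v n x)) -> ~ D y ->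
  exists j (f : I -> M -> M),
    [/\ forall i, linear (f i),
        forall i v n m, f i (mmode (tau i v) n m) = mmode (tau j v) n (f i m),
        forall d, D d -> \sum_i f i (d i) = 0 & \sum_i f i (y i) != 0].
Proof.
move=> sD modD Dy.
pose supp (J : {set I}) (x : X) := forall i, i \notin J -> x i = 0.
have supp_sub J : is_subspace (supp J).
  split=> [i _|c x x' sx sx' i iJ]; first by rewrite ffunE.
  by rewrite !ffunE sx // sx' // scaler0 addr0.
have supp_mode J v n x : supp J x -> supp J (tuple_mode tau v n x).
  by move=> sx i iJ; rewrite ffunE sx // mmode0r.
pose indep (J : {set I}) := `[< forall d, D d -> supp J d -> d = 0 >].
have indep0 : indep finset.set0.
  by apply/asboolP => d _ d0; apply/ffunP => i; rewrite ffunE d0 // finset.in_set0.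
have [J /maxsetP[/asboolP Jindep Jmax] _] := maxset_exists indep0.
(* E is the sum of D and the families supported on J; it turns out to be all of X. *)
pose E (x : X) := exists2 d, D d & supp J (x - d).
have sE : is_subspace E.
  split; first by exists 0; [exact: sD.1 | rewrite subrr; exact: (supp_sub J).1].
  move=> c x x' [d Dd sd] [d' Dd' sd']; exists (c *: d + d'); first exact: sD.2.
  by rewrite opprD addrACA -scalerBr; exact: (supp_sub J).2.
have modE v n x : E x -> E (tuple_mode tau v n x).
  move=> [d Dd sd]; exists (tuple_mode tau v n d); first exact: modD.
  by rewrite -(linB (tuple_mode_linearr hM tau v n)); exact: supp_mode.
have Edelta j m : E (delta j m).
  have [jJ|jJ] := boolP (j \in J).
    exists 0; first exact: sD.1.
    move=> i iJ; rewrite subr0 ffunE; case: eqP => // ij.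
    by rewrite ij jJ in iJ.
  (* By maximality of J some nonzero d in D is supported on J and j; then d j is a nonzero member of
     the submodule of all m with [delta j m] in E. *)
  have [d Dd [sd d0]] : exists2 d, D d & supp (j |: J)%SET d /\ d <> 0.
    apply: contrapT => nd; have /Jmax : indep (j |: J)%SET.
      apply/asboolP => d Dd sd; apply: contrapT => d0.
      by apply: nd; exists d.
    by move=> /(_ (finset.subsetUr _ _)) jJE; rewrite -jJE finset.setU11 in jJ.
  have dj0 : d j <> 0.
    move=> dj; apply: d0; apply: Jindep => // i iJ.
    have [->//|ij] := eqVneq i j.
    by rewrite sd // !inE negb_or ij.
  have [_ _ simM] := irrM; have [] := simM [set m | E (delta j m)].
  - split; first split=> /=.
    + by rewrite (lin0 (delta_linear j)); exact: sE.1.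
    + by move=> c x x' Ex Ex'; rewrite delta_linear; exact: sE.2.
    + move=> v n w /= Ew; have [u <-] := tau_surj j v.
      by rewrite -delta_mode; exact: modE.
  - move=> N0; suff : [set m | E (delta j m)] (d j) by rewrite N0 => /dj0.
    exists d => // i iJ; rewrite !ffunE; case: eqP => [->|/eqP ij].
      by rewrite subrr.
    by rewrite sd ?subrr // !inE negb_or ij.
  - by move=> NT; have : setT m by []; rewrite -NT.
have Eall x : E x by rewrite (delta_sum x); apply: (subspace_sum sE).
(* X is the direct sum of D and the families supported on J; [pr] projects onto the former and [q]
   onto the latter. *)
have /choice[pr prP] : forall x : X, exists d : X, D d /\ supp J (x - d).
  by move=> x; have [d] := Eall x; exists d.
have prU (x d : X) : D d -> supp J (x - d) -> pr x = d.
  move=> Dd sd; apply/eqP; rewrite -subr_eq0; apply/eqP/Jindep.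
    by apply: (subspaceB sD) => //; have [] := prP x.
  rewrite -[pr x - d](subrKA x) -opprB addrC; apply: (subspaceB (supp_sub J)) => //.
  by have [] := prP x.
pose q (x : X) : X := x - pr x.
have ql : linear q.
  move=> c x x'; rewrite /q (@prU _ (c *: pr x + pr x')).
  - by rewrite scalerBr opprD addrACA.
  - by apply: sD.2; have [] := prP x; have [] := prP x'.
  - rewrite opprD addrACA -scalerBr; apply: (supp_sub J).2.
      by have [] := prP x.
    by have [] := prP x'.
have qmode v n x : q (tuple_mode tau v n x) = tuple_mode tau v n (q x).
  have [Dx sx] := prP x.
  rewrite /q (linB (tuple_mode_linearr hM tau v n)) (@prU _ (tuple_mode tau v n (pr x))) //.
    exact: modD.
  by rewrite -(linB (tuple_mode_linearr hM tau v n)); exact: supp_mode.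
have [j qyj] : exists j, q y j != 0.
  apply: contrapT => qy; apply: Dy; have [Dpy _] := prP y.
  suff -> : y = pr y by [].
  apply/eqP; rewrite -subr_eq0; apply/eqP/ffunP => j; rewrite -/(q y) [RHS]ffunE.
  by apply/eqP/negPn/negP => qyj; apply: qy; exists j.
have qE (x : X) : \sum_i q (delta i (x i)) j = q x j.
  by rewrite {2}(delta_sum x) (lin_sum ql) sum_ffunE.
exists j, (fun i m => q (delta i m) j); split.
- by move=> i c x x'; rewrite delta_linear ql !ffunE.
- by move=> i v n m; rewrite -delta_mode qmode ffunE.
- move=> d Dd; rewrite qE /q (@prU d d) ?subrr ?ffunE //.
  exact: (supp_sub J).1.
- by rewrite qE.
Qed.

End Separation.

Section FixedDensity.
Variables (R : realType) (V : voa R) (G : finGroupType) (rho : aut_group V G).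
Variables (M : irr_module V) (phi : proj_action rho M).
Local Notation H := (inertia_type rho M).
Local Notation A := (tga (alpha_cocycle phi)).

Let hM : is_weak_module M. Proof. by have [/module_weak] := irrP M. Qed.

Lemma rho_linear g : linear (rho g). Proof. by have [] := ag_aut rho g. Qed.

Lemma rho_mode g u n v : rho g (mode u n v) = mode (rho g u) n (rho g v).
Proof. by have [] := ag_aut rho g. Qed.

Lemma rhoVK g v : rho g (rho g^-1%g v) = v.
Proof. by rewrite -ag_mul mulgV ag1. Qed.

(** By irreducibility a nonzero T is bijective, so its inverse puts h g^-1 into the inertia group;
    phi(k)^-1 T then commutes with V and Schur's lemma applies. *)
Lemma twisted_hom (T : M -> M) (g h : G) : linear T ->
  (forall v n m, T (mmode (rho g v) n m) = mmode (rho h v) n (T m)) ->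
  (forall m, T m = 0) \/
  exists k c, sgval k = (h * g^-1)%g /\ forall m, T m = c *: phi k m.
Proof.
move=> lT Tm; have [T0|/existsNP[m0 Tm0]] := pselect (forall m, T m = 0); first by left.
right; set k := (h * g^-1)%g.
have Tk v n m : T (mmode v n m) = mmode (rho k v) n (T m).
  by rewrite -{1}(rhoVK g v) Tm ag_mul.
have [_ _ simM] := irrP M.
have Tinj : injective T.
  have [] := simM [set m | T m = 0].
  - split; first split=> /=; first exact: lin0.
    + by move=> c x y /= Tx Ty; rewrite lT Tx Ty scaler0 addr0.
    + by move=> v n w /= Tw; rewrite Tk Tw mmode0r.
  - move=> K0 x y Txy; apply/eqP; rewrite -subr_eq0; apply/eqP.
    suff : [set m | T m = 0] (x - y) by rewrite K0.
    by rewrite /= (linB lT) Txy subrr.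
  - by move=> KT; case: Tm0; have : setT m0 by []; rewrite -KT.
have Tsurj y : exists x, T x = y.
  have [] := simM (range T).
  - split; first split=> /=; first by exists 0 => //; exact: lin0.
    + by move=> c _ _ [x _ <-] [y' _ <-]; exists (c *: x + y') => //; rewrite lT.
    + move=> v n _ [w _ <-]; exists (mmode (rho k^-1%g v) n w) => //.
      by rewrite Tk rhoVK.
  - move=> T0; case: Tm0; have : range T (T m0) by exists m0.
    by rewrite T0.
  - by move=> TT; have : setT y by []; rewrite -TT => -[x _ <-]; exists x.
have /choice[S TS] := Tsurj.
have ST : cancel T S by move=> x; apply: Tinj; rewrite TS.
have Sl : linear S by move=> c x y; apply: Tinj; rewrite lT !TS.
have kH : k \in inertia_group rho M.
  rewrite inE; apply/asboolP; exists S; split=> //; first by exists T.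
  by move=> v n w /=; apply: Tinj; rewrite Tk !TS.
pose kk : H := subg (inertia_group rho M) k.
have kkE : sgval kk = k by rewrite subgK.
have [psi phiK Kphi] := pa_bij phi kk.
have psil : linear psi.
  by move=> c x y; apply: (can_inj phiK); rewrite (pa_linear phi kk) !Kphi.
have [|v n w|c cE] := @schur _ _ M (psi \o T) (irrP M).
- by move=> c x y /=; rewrite lT psil.
- by rewrite /= Tk; apply: (can_inj phiK); rewrite (pa_conj phi kk) !Kphi kkE.
- exists kk, c; split=> // m; apply: (can_inj Kphi).
  by rewrite (linZ psil) phiK -cE.
Qed.

Lemma fixed_average (v : V) :
  (#|G|%:R)^-1 *: \sum_g rho g v \in fixed_pred rho.
Proof.
apply/fixed_predP => h; rewrite (linZ (rho_linear h)) (lin_sum (rho_linear h)).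
congr (_ *: _); rewrite [RHS](reindex_inj (mulgI h)) /=.
by apply: eq_bigr => g _; rewrite ag_mul.
Qed.

(* Separate the constant families (w j), (z j) in the sum of all twists
   M o g: by twisted_hom a separating homomorphism is an element of A^J. *)
Lemma fixed_density (J : finType) (w z : J -> M) :
  (forall a : J -> A, \sum_j tga_act (a j) (w j) = 0 ->
     \sum_j tga_act (a j) (z j) = 0) ->
  exists s : seq (fixed_space rho * rat), forall j,
    z j = \sum_(p <- s) mmode (fixed_val p.1) p.2 (w j).
Proof.
move=> wz; pose tau (p : G * J) := (rho p.1 : V -> V).
have tl p : linear (tau p) by exact: rho_linear.
have tm p u n v : tau p (mode u n v) = mode (tau p u) n (tau p v) by exact: rho_mode.
have ts p v : exists u, tau p u = v by exists (rho p.1^-1%g v); exact: rhoVK.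
pose x : {ffun G * J -> M} := [ffun p => w p.2].
pose y : {ffun G * J -> M} := [ffun p => z p.2].
have [[s ys]|ny] := pselect (mode_span tau x y).
  exists [seq (FixedSpace (fixed_average p.1), p.2) | p <- s] => j.
  (* One combination of modes works in every twist; averaging these identities over g replaces each
     v by its average in V^G. *)
  have zg g : z j = \sum_(p <- s) mmode (rho g p.1) p.2 (w j).
    have /ffunP/(_ (g, j)) := ys; rewrite ffunE /= => ->.
    by rewrite sum_ffunE; apply: eq_bigr => p _; rewrite !ffunE.
  have G0 : #|G|%:R != 0 :> R[i].
    by rewrite pnatr_eq0 -lt0n; apply/card_gt0P; exists 1%g.
  have -> : z j = (#|G|%:R)^-1 *: \sum_(g : G) z j.
    rewrite sumr_const -[z j *+ _]scaler_nat scalerA mulVf ?scale1r //.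
  rewrite (eq_bigr _ (fun g _ => zg g)) big_map.
  rewrite exchange_big /= scaler_sumr.
  apply: eq_bigr => p _; have ml := mmode_linearl hM p.2 (w j).
  by rewrite (linZ ml) (lin_sum ml).
have sx := mode_span_subspace hM tl x.
have [[g0 j0] [f [fl fm fD fy]]] := submodule_separation (irrP M) ts sx
  (fun v n d => @mode_span_closed _ _ _ hM _ _ tl tm x v n d) ny.
(* Extending phi by 0 outside the inertia group gives one formula for zero and nonzero
   components. *)
pose phi' (k : G) (m : M) := if k \in inertia_group rho M
  then phi (subg (inertia_group rho M) k) m else 0.
have /choice[c cE] : forall p, exists c, forall m,
    f p m = c *: phi' (g0 * p.1^-1)%g m.
  move=> p; have [f0|[k [c [kE fE]]]] := twisted_hom (fl p) (fm p).
    by exists 0 => m; rewrite f0 scale0r.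
  exists c => m; rewrite fE /phi' -kE subgP.
  by rewrite sgvalK.
(* Solving k = g0 g^-1 for g collects the coefficients of the phi(k) into an element of A. *)
pose a j : A := [ffun k : H => c ((sgval k)^-1 * g0, j)%g].
have fa (u : J -> M) : \sum_p f p (u p.2) = \sum_j tga_act (a j) (u j).
  transitivity (\sum_g \sum_j f (g, j) (u j)).
    by rewrite pair_bigA; apply: eq_bigr => -[].
  rewrite exchange_big /=.
  apply: eq_bigr => j _; rewrite (reindex_inj invg_inj) (reindex_inj (mulgI g0^-1%g)) /=.
  transitivity (\sum_(k in inertia_group rho M)
      c (k^-1 * g0, j)%g *: phi (subg (inertia_group rho M) k) (u j)).
    rewrite [RHS]big_mkcond; apply: eq_bigr => k _.
    rewrite cE /= !invgK mulKVg invMg invgK /phi'.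
    by case: ifP => // _; rewrite scaler0.
  rewrite (reindex_onto (@sgval _ _) (subg (inertia_group rho M))) => [|k kH] /=; last first.
    by rewrite subgK.
  rewrite /tga_act; apply: eq_big => [k|k _]; first by rewrite subgP sgvalK eqxx.
  by rewrite ffunE sgvalK.
case/negP: fy; rewrite -(eq_bigr _ (fun p _ => congr1 (f p) (esym (ffunE _ p)))) fa.
apply/eqP/wz; rewrite -fa -[RHS](fD x).
  by apply: eq_bigr => p _; rewrite ffunE.
(* The vacuum mode shows that x lies in its own mode span, on which the separating homomorphism
   vanishes. *)
have := mode_span_mode tau x (vacuum V) (-1); suff -> : tuple_mode tau (vacuum V) (-1) x = x by [].
apply/ffunP => p; have [_ _ vac _ _] := ag_aut rho p.1.
by rewrite ffunE /tau vac (mmode_vacuum hM) eqxx.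
Qed.

End FixedDensity.

(** * Independence of the projective action *)

Section Independence.
Variables (R : realType) (V : voa R) (G : finGroupType) (rho : aut_group V G).
Variables (M : irr_module V) (phi : proj_action rho M).
Local Notation H := (inertia_type rho M).

Let hM : is_weak_module M. Proof. by have [/module_weak] := irrP M. Qed.

(** Relations \sum_g Y(a g, z) phi(g) = 0 with coefficients in V; scalar relations are those whose
    entries are multiples of the vacuum. *)
Definition mode_relation : set {ffun H -> V} :=
  [set a | forall n w, \sum_g mmode (a g) n (phi g w) = 0].

Lemma mode_relation_subspace : is_subspace mode_relation.
Proof.
split=> [n w|c a b Ka Kb n w]; first by rewrite big1 // => g _; rewrite ffunE (mmode0l hM).
under eq_bigr do rewrite !ffunE (mmode_linearl hM).
by rewrite big_split -scaler_sumr /= Ka Kb scaler0 addr0.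
Qed.

(* Locality: (z1 - z2)^l kills the commutators of Y(u, z1) with all Y(a g, z2),
   so \sum_g Y(a g, z2) Y(u, z1) phi(g) w vanishes as well. *)
Lemma mode_relation_right (u : V) (a : {ffun H -> V}) (b c : rat) w :
  mode_relation a -> \sum_g mmode (a g) b (mmode u c (phi g w)) = 0.
Proof.
move=> Ka; have [l uv] := uniform_bound (fun g : H => mode_trunc u 0 (a g)).
have [d] := uniform_bound (fun g : H => mmode_trunc hM u c (phi g w)).
elim: d b c => [|d IH] b c uw.
  by rewrite big1 // => g _; rewrite -[c]addr0 (uw g 0%N) // (mmode0r hM).
have [N1 aw] := uniform_bound (fun g : H => mmode_trunc hM (a g) (b - l%:R) (phi g w)).
(* The shift b - l makes (a g)_b u_c the i = 0 term of the second sum; the first sum vanishes by the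
   relation, the terms with i > 0 by induction. *)
have jac g := @mmode_jacobi_trunc _ _ _ hM u (a g) (phi g w) l c (b - l%:R) N1 d.+1 0
  (aw g) (uw g) (fun i _ => uv g _ (leq_addr i l)).
have := @eq_bigr M 0 +%R H (index_enum H) xpredT _ _ (fun g _ => jac g).
rewrite sumrB exchange_big /= big1 => [|i _]; last first.
  rewrite -scaler_sumr -(lin_sum (mmode_linearr hM _ _)) Ka.
  by rewrite (mmode0r hM) scaler0.
rewrite sub0r [RHS]big1 => [|g _]; last by case: ifP; rewrite ?big_ord0.
move/eqP; rewrite oppr_eq0 -scaler_sumr scaler_eq0 expfz_eq0 oppr_eq0 oner_eq0.
rewrite andbF /= exchange_big /= big_ord_recl [X in _ + X]big1 => [|i _]; last first.
  rewrite -scaler_sumr IH ?scaler0 // => g k dk; rewrite -addrA -natrD.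
  by apply: uw; rewrite lift0 addSn ltnS (leq_trans dk) // leq_addl.
rewrite addr0 -scaler_sumr expr0 gbinom0 mulr1 scale1r => /eqP E; rewrite -[RHS]E.
by apply: eq_bigr => g _; rewrite addr0 subr0 subrK.
Qed.

(** Taking l := m and 0 for the middle index of the Jacobi identity leaves only the i = 0 term on
    the right; both sums on the left vanish, by the relation and by [mode_relation_right]. *)
Lemma mode_relation_left (u : V) (m : int) (a : {ffun H -> V}) :
  mode_relation a -> mode_relation [ffun g => mode u m (a g)].
Proof.
move=> Ka n w.
have [N1 aw] := uniform_bound (fun g : H => mmode_trunc hM (a g) n (phi g w)).
have [N2 uw] := uniform_bound (fun g : H => mmode_trunc hM u 0 (phi g w)).
have [N3 uv] := uniform_bound (fun g : H => mode_trunc u m (a g)).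
have jac g := @mmode_jacobi_trunc _ _ _ hM u (a g) (phi g w) m 0 n N1 N2 N3.+1
  (aw g) (uw g) (fun i Ni => uv g i (ltnW Ni)).
have := @eq_bigr M 0 +%R H (index_enum H) xpredT _ _ (fun g _ => jac g).
rewrite sumrB exchange_big /= big1 => [|i _]; last first.
  rewrite -scaler_sumr -(lin_sum (mmode_linearr hM _ _)) Ka.
  by rewrite (mmode0r hM) scaler0.
rewrite -scaler_sumr exchange_big /= big1 => [|i _]; last first.
  by rewrite -scaler_sumr mode_relation_right ?scaler0.
rewrite scaler0 subr0 => E; symmetry; rewrite {1}E; apply: eq_bigr => g _.
rewrite rmorph0 big_ord_recl gbinom0 scale1r big1 => [|i _].
  by rewrite ffunE !addr0 add0r.
by rewrite lift0 gbinom0l scale0r.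
Qed.

Hypothesis V_simple : voa_simple V.

(* Among the nonzero mode relations of minimal support S, one has the vacuum
   as its g1-component.  Its other components commute with V modulo relations
   of smaller support, hence act by scalars s g; comparing
   \sum_g s g *: phi g = 0 with its conjugates by Y(v, z) gives a relation
   supported on S minus g1. *)
Lemma proj_action_free (c : H -> R[i]) :
  (forall w, \sum_g c g *: phi g w = 0) -> forall g, c g = 0.
Proof.
move=> c0 g0; apply: contrapT => /eqP cg0.
have [_ [w0 w0_neq0] _] := irrP M.
have vacM n w : mmode (vacuum V) n w = if n == -1 then w else 0 :> M.
  exact: mmode_vacuum hM n w.
pose supp (S : {set H}) (a : {ffun H -> V}) := forall g, g \notin S -> a g = 0.
have supp_sub S : is_subspace (supp S).
  split=> [g _|d x y sx sy g gS]; first by rewrite ffunE.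
  by rewrite !ffunE sx // sy // scaler0 addr0.
pose rel (S : {set H}) := `[< exists a, [/\ mode_relation a, supp S a & a <> 0] >].
have [S /minsetP[/asboolP[a [Ka Sa a0]] Smin] _] : {S | minset rel S & S \subset finset.setT}.
  apply: minset_exists; apply/asboolP; exists [ffun g => c g *: vacuum V]; split.
  - move=> n w; have [->|nN] := eqVneq n (-1).
      rewrite -[RHS](c0 w); apply: eq_bigr => g _.
      by rewrite ffunE (linZ (mmode_linearl hM _ _)) vacM eqxx.
    rewrite big1 // => g _; rewrite ffunE (linZ (mmode_linearl hM _ _)).
    by rewrite vacM (negPf nN) scaler0.
  - by move=> g; rewrite finset.in_setT.
  - move=> /ffunP/(_ g0); rewrite !ffunE => cv.
    have := mmode0l hM (-1) w0; rewrite -cv (linZ (mmode_linearl hM _ _)) vacM eqxx.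
    by move/eqP; rewrite scaler_eq0 (negPf cg0) (negPf w0_neq0).
have [g1 ag1] : exists g1, a g1 <> 0.
  apply: contrapT => na; apply: a0; apply/ffunP => g; rewrite ffunE.
  by apply: contrapT => ag; apply: na; exists g.
have g1S : g1 \in S by apply/negPn/negP => /Sa.
have rel0 b : mode_relation b -> supp S b -> b g1 = 0 -> b = 0.
  move=> Kb Sb bg1; apply: contrapT => b0.
  have /Smin : rel (S :\ g1)%SET.
    apply/asboolP; exists b; split=> // g; rewrite !inE negb_and negbK.
    by case/orP => [/eqP->|/Sb].
  by move=> /(_ (subsetDl _ _)) SE; move: g1S; rewrite -SE !inE eqxx.
(* The g1-components of relations supported on S form an ideal, nonzero because it contains [a g1],
   hence all of V. *)
pose J := [set v : V | exists b, [/\ mode_relation b, supp S b & b g1 = v]].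
have idJ : is_ideal J.
  apply: left_ideal_ideal.
    split; first exists 0; first by split; [exact: mode_relation_subspace.1 | exact: (supp_sub S).1 | rewrite ffunE].
    move=> d _ _ [b [Kb Sb <-]] [b' [Kb' Sb' <-]]; exists (d *: b + b'); split.
    - exact: mode_relation_subspace.2.
    - exact: (supp_sub S).2.
    - by rewrite !ffunE.
  move=> u n _ [b [Kb Sb <-]]; exists [ffun g => mode u n (b g)]; split.
  - exact: mode_relation_left.
  - by move=> g gS; rewrite ffunE Sb // mode0r.
  - by rewrite ffunE.
have [b [Kb Sb bg1]] : J (vacuum V).
  have [J0|->//] := V_simple idJ.
  case: ag1; suff : J (a g1) by rewrite J0.
  by exists a.
(* u_i 1 = 0 for i >= 0, so the relation with entries u_i (b g) has zero g1-component and
   vanishes. *)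
have bcomm u (i : nat) g : mode u i%:Z (b g) = 0.
  have := rel0 [ffun g => mode u i%:Z (b g)].
  rewrite ffunE bg1 (mode_creation0 (voaP V)) // => /(_ _ _ erefl) E.
  suff /ffunP/(_ g) : [ffun h => mode u i%:Z (b h)] = 0 by rewrite !ffunE.
  apply: E; first exact: mode_relation_left.
  by move=> h hS; rewrite ffunE Sb // mode0r.
have /choice[s sE] : forall g : H, exists d : R[i], forall w : M, mmode (b g) (-1) w = d *: w.
  move=> g; apply: (schur (irrP M)) => [|v n w]; first exact: mmode_linearr.
  by apply/esym/(mmode_commute hM) => i; exact: bcomm.
have s_rel w : \sum_g s g *: phi g w = 0.
  by rewrite -[RHS](Kb (-1) w); apply: eq_bigr => g _; rewrite sE.
have s0 g : g != g1 -> s g = 0.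
  move=> gg1; apply: contrapT => /eqP sg0; case/eqP: gg1; apply: (can_inj (@sgvalK _ (inertia_group rho M))).
  apply: (@ag_faithful _ _ _ rho) => v.
  (* This relation has zero g1-component, so it vanishes; as s g is nonzero, g and g1 agree on v,
     and faithfulness gives g = g1. *)
  pose d : {ffun H -> V} := [ffun h => s h *: (rho (sgval h) v - rho (sgval g1) v)].
  have /ffunP/(_ g) : d = 0.
    apply: rel0.
    - move=> n w; transitivity (\sum_h s h *: phi h (mmode v n w)
          - mmode (rho (sgval g1) v) n (\sum_h s h *: phi h w)).
        rewrite (lin_sum (mmode_linearr hM _ _)) -sumrB; apply: eq_bigr => h _.
        rewrite ffunE (linZ (mmode_linearl hM _ _)) (linB (mmode_linearl hM _ _)).
        by rewrite scalerBr (pa_conj phi h) (linZ (mmode_linearr hM _ _)).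
      by rewrite !s_rel (mmode0r hM) subr0.
    - move=> h hS; rewrite ffunE; have := sE h w0; rewrite Sb // (mmode0l hM) //.
      by move/esym/eqP; rewrite scaler_eq0 (negPf w0_neq0) orbF => /eqP->; rewrite scale0r.
    - by rewrite ffunE subrr scaler0.
  rewrite !ffunE => /eqP; rewrite scaler_eq0 (negPf sg0) subr_eq0 => /eqP.
  by [].
(* Only the g1-term is left, and s g1 = 1 since b g1 is the vacuum; this contradicts injectivity of
   phi(g1). *)
have := s_rel w0; rewrite (bigD1 g1) //= big1 ?addr0 => [|g gg1]; last first.
  by rewrite s0 // scale0r.
rewrite -sE bg1 vacM eqxx => /eqP; apply/negP; apply: contra w0_neq0 => /eqP p0.
by apply/eqP/(bij_inj (pa_bij phi g1)); rewrite p0 (lin0 (pa_linear phi g1)).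
Qed.

End Independence.

(** * Linear algebra *)

Section Diagonalization.
Variables (R : realType) (U : lmodType R[i]) (T : U -> U).
Hypothesis lT : linear T.

(** A polynomial in T with root list s, applied to x; if it vanishes for distinct roots, x is a sum
    of eigenvectors. *)
Definition kill (s : seq R[i]) (x : U) : U :=
  foldl (fun y c => T y - c *: y) x s.

Lemma kill_linear s : linear (kill s).
Proof.
elim: s => //= c s IH d x y; rewrite /kill /= -!/(kill s _) -IH lT.
congr kill; rewrite !scalerDr scalerN !scalerA [c * d]mulrC opprD.
by rewrite addrACA.
Qed.

Lemma kill_eigen s c x : T x = c *: x -> c \in s -> kill s x = 0.
Proof.
elim: s => //= d s IH Tx; rewrite inE /kill /= -/(kill s _) Tx -scalerBl.
rewrite (linZ (kill_linear s)) => /orP[/eqP->|/IH->//]; last by rewrite scaler0.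
by rewrite subrr scale0r.
Qed.

(** Allowing every larger list lets finitely many vectors be killed by a common one. *)
Lemma kill_sum_eigen x : sum_subspaces (range (eigenspace_of T)) x ->
  exists s : seq R[i], forall s' : seq R[i], {subset s <= s'} -> kill s' x = 0.
Proof.
move=> [t [tE ->]]; elim: t tE => [|y t IH] tE.
  by exists nil => s' _; rewrite big_nil (lin0 (kill_linear s')).
have [z zt|s sP] := IH; first by apply: tE; rewrite inE zt orbT.
have [_ [c _ <-] Ty] := tE y (mem_head _ _).
exists (c :: s) => s' ss'; rewrite big_cons (linD (kill_linear s')).
rewrite (kill_eigen Ty) ?add0r ?sP // => [d ds|]; last by rewrite ss' ?mem_head.
by rewrite ss' // inE ds orbT.
Qed.

(* A solution h of T h - c h = T x - c x is obtained termwise from a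
   decomposition of the right-hand side over the other eigenvalues. *)
Lemma kill_decomposition s x : uniq s -> kill s x = 0 ->
  exists t : seq (R[i] * U),
    (forall p, p \in t -> p.1 \in s /\ T p.2 = p.1 *: p.2) /\
    x = \sum_(p <- t) p.2.
Proof.
elim: s x => [|c s IH] x /=; first by move=> _ ->; exists nil; rewrite big_nil.
move=> /andP[cs us] /(IH _ us)[t [tE xE]].
pose h := \sum_(p <- t) (p.1 - c)^-1 *: p.2.
have hE : T h - c *: h = T x - c *: x.
  rewrite xE /h (lin_sum lT) scaler_sumr -sumrB; apply: eq_big_seq => p pt.
  have [ps Tp] := tE p pt; rewrite (linZ lT) Tp !scalerA -scalerBl.
  rewrite mulrC -mulrBl mulfV ?scale1r // subr_eq0.
  by apply: contra cs => /eqP <-.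
exists ((c, x - h) :: [seq (p.1, (p.1 - c)^-1 *: p.2) | p <- t]); split.
  move=> p; rewrite inE => /orP[/eqP->/=|/mapP[p' /tE[ps Tp] ->]] /=.
    split; first exact: mem_head.
    have -> : T (x - h) = T h - c *: h + c *: x - T h by rewrite hE subrK (linB lT).
    by rewrite addrC -[X in _ + X]addrA addKr addrC scalerBr.
  split; first by rewrite inE ps orbT.
  by rewrite (linZ lT) Tp !scalerA mulrC.
by rewrite big_cons big_map /= subrK.
Qed.

End Diagonalization.

Section FiniteDimension.
Variables (R : realType) (U : lmodType R[i]).

(* Q r x: r is one of the possible coordinate vectors of x. *)
Lemma fin_dim_coordinates (P : set U) (m : nat) (Q : 'rV[R[i]]_m -> U -> Prop) :
  (forall x, P x -> exists r, Q r x) ->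
  (forall c r x r' x', Q r x -> Q r' x' -> Q (c *: r + r') (c *: x + x')) ->
  (forall x, Q 0 x -> x = 0) ->
  fin_dim P.
Proof.
move=> PQ Ql Q0; have [P0|] := pselect (P `<=` set0).
  by exists 0%N, (fun=> 0) => x /P0.
move=> /existsNP[x0 /not_implyP[Px0 _]].
have Q00 : Q 0 0.
  by have [r Qr] := PQ _ Px0; have := Ql (-1) _ _ _ _ Qr Qr; rewrite !scaleN1r !addNr.
(* Coordinate vectors are chosen with row space of maximal dimension; elements having these
   coordinates then span a space containing P. *)
pose rk (k : nat) := `[< exists n (A : 'M[R[i]]_(n, m)),
  (forall i, exists x, Q (row i A) x) /\ \rank A = k >].
have rk0 : exists k, rk k.
  by exists 0%N; apply/asboolP; exists 0%N, 0; split; [case | rewrite mxrank0].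
have rkm k : rk k -> (k <= m)%N.
  by move=> /asboolP[n [A [_ <-]]]; exact: rank_leq_col.
case: (ex_maxnP rk0 rkm) => k /asboolP[n [A [/choice[b Qb] rA]]] kmax.
exists n, b => x /PQ[r Qr].
have rA' : (r <= A)%MS.
  have : rk (\rank (col_mx A r)).
    apply/asboolP; exists (n + 1)%N, (col_mx A r); split=> // i.
    case: (splitP i) => j ij.
      have -> : i = lshift 1 j by exact: val_inj.
      by exists (b j); rewrite rowKu.
    have -> : i = rshift n j by exact: val_inj.
    by exists x; rewrite rowKd ord1 row_id.
  move=> /kmax; rewrite -rA -addsmxE => rAr.
  have := geq_leqif (mxrank_leqif_sup (addsmxSl A r)); rewrite rAr.
  by move=> /esym/(submx_trans (addsmxSr A r)).
have [D rD] := submxP rA'.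
exists (fun i => D 0 i); apply/eqP; rewrite -subr_eq0; apply/eqP/Q0.
have Qsum (s : seq 'I_n) : Q (\sum_(i <- s) D 0 i *: row i A) (\sum_(i <- s) D 0 i *: b i).
  elim: s => [|i s IH]; first by rewrite !big_nil.
  by rewrite !big_cons; exact: Ql.
(* The combination of the b i and x share the coordinate vector r, so their difference has
   coordinates 0. *)
have := Ql (-1) _ _ _ _ (Qsum (index_enum 'I_n)) Qr.
by rewrite -mulmx_sum_row -rD !scaleN1r addNr addrC.
Qed.

End FiniteDimension.

(** * Characters and homomorphisms of simple modules *)

Section AlgebraModules.
Variables (R : realType) (A : algType R[i]).

(** With P and Q the matrices of f and its inverse, and C that of a on W2, tr(Q C P) = tr(C P Q) and
    P Q = 1. *)
Lemma character_iso (W1 W2 : fd_module A) (f : W1 -> W2) :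
  alg_hom (fd_act W1) (fd_act W2) f -> bijective f ->
  character W1 = character W2.
Proof.
move=> [lf fa] [g fK gK]; apply/funext => a; rewrite /character /trace.
have lg : linear g by move=> c x y; apply: (can_inj fK); rewrite lf !gK.
set b1 := vbasis {:W1}; set b2 := vbasis {:W2}.
have e1 x : x = \sum_i coord b1 i x *: b1`_i by rewrite {1}(coord_vbasis (memvf x)).
have e2 x : x = \sum_i coord b2 i x *: b2`_i by rewrite {1}(coord_vbasis (memvf x)).
have fr2 : free b2 := basis_free (vbasisP _).
pose C (j k : 'I_(\dim {:W2})) := coord b2 j (fd_act W2 a b2`_k).
pose P (j : 'I_(\dim {:W2})) (i : 'I_(\dim {:W1})) := coord b2 j (f b1`_i).
pose Q (i : 'I_(\dim {:W1})) (j : 'I_(\dim {:W2})) := coord b1 i (g b2`_j).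
have PQ k j : \sum_i P k i * Q i j = (j == k)%:R.
  rewrite -(coord_free j k fr2).
  rewrite -[b2`_j]gK (e1 (g b2`_j)) (lin_sum lf).
  rewrite linear_sum; apply: eq_bigr => i _.
  by rewrite (linZ lf) linearZ /= mulrC.
transitivity (\sum_i \sum_j \sum_k P k i * C j k * Q i j).
  apply: eq_bigr => i _.
  rewrite -[fd_act W1 a _]fK fa (e2 (f b1`_i)) (lin_sum (act_linearr (fd_act W2) a)).
  rewrite exchange_big (lin_sum lg) linear_sum; apply: eq_bigr => k _ /=.
  rewrite (linZ (act_linearr (fd_act W2) a)) (linZ lg) linearZ /=.
  rewrite [in g _](e2 (fd_act W2 a _)) (lin_sum lg) linear_sum mulr_sumr.
  by apply: eq_bigr => j _; rewrite (linZ lg) linearZ /= mulrA.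
transitivity (\sum_j \sum_k C j k * \sum_i P k i * Q i j).
  rewrite exchange_big; apply: eq_bigr => j _; rewrite exchange_big.
  apply: eq_bigr => k _; rewrite mulr_sumr; apply: eq_bigr => i _.
  by rewrite mulrA [C j k * _]mulrC.
apply: eq_bigr => j _; under eq_bigr do rewrite PQ.
rewrite (bigD1 j) //= eqxx mulr1 big1 ?addr0 // => k kj.
by rewrite eq_sym (negPf kj) mulr0.
Qed.

Variables (W : fd_module A) (M : lmodType R[i]) (actM : alg_action A M).
Hypothesis simW : simple_module W.

Lemma simple_hom_inj (f : W -> M) : alg_hom (fd_act W) actM f ->
  (exists w, f w <> 0) -> injective f.
Proof.
move=> [lf fa] [w0 fw0] x y fxy; have [_ /(_ [set w | f w = 0])[]] := simW.
- split; first split=> /=; first exact: lin0.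
  + by move=> c u v /= fu fv; rewrite lf fu fv scaler0 addr0.
  + by move=> a w /= fw; rewrite fa fw (lin0 (act_linearr actM a)).
- move=> K0; apply/eqP; rewrite -subr_eq0; apply/eqP.
  suff : [set w | f w = 0] (x - y) by rewrite K0.
  by rewrite /= (linB lf) fxy subrr.
- by move=> KT; case: fw0; have : setT w0 by []; rewrite -KT.
Qed.

Lemma simple_isotypic (f : W -> M) : alg_hom (fd_act W) actM f ->
  (exists w, f w <> 0) -> isotypic W actM <> [set 0].
Proof.
move=> hf [w fw] iso0; apply: (fw); suff : isotypic W actM (f w) by rewrite iso0.
have [lf fa] := hf.
exists [:: f w]; split; last by rewrite big_seq1.
move=> y; rewrite inE => /eqP->; exists (range f); last by exists w.
split; last by exists f; split=> //; apply: (simple_hom_inj hf); exists w.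
split; first split; first by exists 0 => //; exact: lin0.
- by move=> c _ _ [u _ <-] [v _ <-]; exists (c *: u + v) => //; rewrite lf.
- by move=> a _ [u _ <-]; exists (fd_act W a u) => //; rewrite fa.
Qed.

(* If the images of f1 and f2 meet, each is contained in the other. *)
Lemma simple_hom_disjoint (W2 : fd_module A) (f1 : W -> M) (f2 : W2 -> M) :
  simple_module W2 ->
  alg_hom (fd_act W) actM f1 -> alg_hom (fd_act W2) actM f2 ->
  injective f1 -> injective f2 -> character W <> character W2 ->
  forall w1 w2, f1 w1 + f2 w2 = 0 -> w1 = 0.
Proof.
move=> simW2 [l1 a1] [l2 a2] i1 i2 chi w1 w2 w12; apply: contrapT => w1_neq0.
(* The w with f1 w in the range of f2 form a submodule containing w1, so f1 factors as f2 after S;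
   simplicity of W2 makes S onto. *)
apply: chi; have /choice[S SE] : forall w, exists w', f1 w = f2 w'.
  move=> w; have [_ /(_ [set w | exists w', f1 w = f2 w'])[]] := simW.
  - split; first split=> /=; first by exists 0; rewrite (lin0 l1) (lin0 l2).
    + by move=> c x y [x' xx'] [y' yy']; exists (c *: x' + y'); rewrite l1 l2 xx' yy'.
    + by move=> a x [x' xx']; exists (fd_act W2 a x'); rewrite a1 a2 xx'.
  - move=> N0; case: w1_neq0; suff : [set w | exists w', f1 w = f2 w'] w1 by rewrite N0.
    by exists (- w2); apply/eqP; rewrite -scaleN1r (linZ l2) scaleN1r -addr_eq0 w12.
  - by move=> NT; have : setT w by []; rewrite -NT.
have lS : linear S by move=> c x y; apply: i2; rewrite -SE l1 l2 !SE.
have aS a w : S (fd_act W a w) = fd_act W2 a (S w).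
  by apply: i2; rewrite -SE a1 a2 SE.
have Sinj : injective S by move=> x y Sxy; apply: i1; rewrite !SE Sxy.
have /choice[T TE] : forall y, exists x, S x = y.
  move=> y; have [_ /(_ (range S))[]] := simW2.
  - split; first split; first by exists 0 => //; exact: lin0.
    + by move=> c _ _ [u _ <-] [v _ <-]; exists (c *: u + v) => //; rewrite lS.
    + by move=> a _ [u _ <-]; exists (fd_act W a u) => //; rewrite aS.
  - move=> S0; case: w1_neq0; apply: Sinj; rewrite (lin0 lS).
    by have : range S (S w1) by [exists w1]; rewrite S0.
  - by move=> ST; have : setT y by []; rewrite -ST => -[x _ <-]; exists x.
apply: (@character_iso W W2 S) => //.
by exists T => // x; apply: Sinj; rewrite TE.
Qed.

End AlgebraModules.

(** * Multiplicity spaces *)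

Section MultiplicityModules.
Variables (R : realType) (V : voa R) (G : finGroupType) (rho : aut_group V G).
Variables (M : irr_module V) (phi : proj_action rho M).
Local Notation H := (inertia_type rho M).
Local Notation A := (tga (alpha_cocycle phi)).

Let hM : is_weak_module M. Proof. by have [/module_weak] := irrP M. Qed.

Lemma tga_act_sum (W : lmodType R[i]) (actW : alg_action A W) (a : A) w :
  actW a w = \sum_x a x *: actW (tga_basis _ x) w.
Proof.
rewrite {1}(tga_basis_sum a) (lin_sum (act_linearl actW w)).
by apply: eq_bigr => x _; rewrite (linZ (act_linearl actW w)).
Qed.

Section OneModule.
Variable W : fd_module A.
Local Notation Hom := (hom_space W (tga_action phi)).
Local Notation b := (vbasis {:W}).

(* The twisted group algebra is Frobenius: a functional on W that does not
   vanish at w0 spreads out to a homomorphism W -> M, which is nonzero at w0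
   for a suitable m because the phi g are independent. *)
Lemma simple_module_occurs : voa_simple V -> (exists w : W, w != 0) ->
  exists f : Hom, exists w, f w <> 0.
Proof.
move=> V_simple [w0 w0_neq0].
have [i li] : exists i, coord b i w0 != 0.
  apply: contrapT => nl; case/eqP: w0_neq0; rewrite (coord_vbasis (memvf w0)).
  rewrite big1 // => i _; suff -> : coord b i w0 = 0 by rewrite scale0r.
  by apply/eqP/negPn/negP => li; apply: nl; exists i.
pose al : H -> H -> R[i] := alpha_cocycle phi.
(* al(g, g^-1)^-1 bar(g^-1) is the inverse of bar g, so d w g is the i-th coordinate of (bar g)^-1
   w. *)
pose d w (g : H) := (al g g^-1%g)^-1 * coord b i (fd_act W (tga_basis _ g^-1%g) w).
have [m fm] : exists m, \sum_g d w0 g *: phi g m <> 0.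
  apply: contrapT => nm; case/eqP: li.
  have /(_ 1%g)/eqP : forall g, d w0 g = 0.
    apply: (@proj_action_free _ _ _ _ _ phi V_simple (d w0)) => m.
    by apply: contrapT => fm; apply: nm; exists m.
  rewrite /d invg1 /al cocycle1l invr1 mul1r => /eqP.
  by rewrite (act_1 (fd_act W)).
pose f w := \sum_g d w g *: phi g m.
have lf : linear f.
  move=> c x y; rewrite /f scaler_sumr -big_split; apply: eq_bigr => g _ /=.
  rewrite scalerA -scalerDl /d (act_linearr (fd_act W) _) linearP /=.
  by rewrite mulrDr mulrCA.
have fh h w : f (fd_act W (tga_basis _ h) w) = phi h (f w).
  rewrite /f (lin_sum (pa_linear phi h)) (reindex_inj (mulgI h)) /=.
  apply: eq_bigr => k _; rewrite (linZ (pa_linear phi h)) alphaE scalerA.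
  congr (_ *: _); rewrite /d -(act_M (fd_act W)) tga_basisM.
  rewrite (linZ (act_linearl (fd_act W) _)) linearZ /= invMg mulgVK.
  have n x y : al x y != 0 := cocycle_neq0 (alpha_cocycle phi) x y.
  (* The cocycle identities at (hk, (hk)^-1, h) and (h, k, k^-1) cancel the scalars produced by
     moving bar h across. *)
  have := cocycleP (alpha_cocycle phi) (h * k)%g (k^-1 * h^-1)%g h.
  rewrite -invMg mulgV cocycle1l mulr1 invMg mulgVK -/al => ->.
  have := cocycleP (alpha_cocycle phi) h k k^-1%g.
  rewrite mulgV cocycle1r mul1r -/al => <-.
  rewrite -[alpha phi _ h]/(al _ h) -[alpha phi h k]/(al h k).
  rewrite !invfM -!mulrA; set X := coord b i _.
  rewrite [(al (k^-1 * h^-1)%g h)^-1 * _]mulKf // [RHS]mulrC -!mulrA.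
  by rewrite mulfV // mulr1.
have fA : alg_hom (fd_act W) (tga_action phi) f.
  split=> // a w; rewrite tga_act_sum (lin_sum lf); apply: eq_bigr => g _.
  by rewrite (linZ lf) fh.
by exists (HomSpace (introT (asboolP _) fA : f \in hom_pred W (tga_action phi))), w0.
Qed.

Lemma hom_valP (f : Hom) : alg_hom (fd_act W) (tga_action phi) f.
Proof. by case: f => f /= /asboolP. Qed.

Lemma hom_eqP (f g : Hom) : (forall w, f w = g w) -> f = g.
Proof. by move=> fg; apply/val_inj/funext. Qed.

Lemma hom_basisP (f g : Hom) : (forall j : 'I_(\dim {:W}), f b`_j = g b`_j) -> f = g.
Proof.
move=> fg; apply: hom_eqP => w; have [lf _] := hom_valP f; have [lg _] := hom_valP g.
rewrite (coord_vbasis (memvf w)) (lin_sum lf) (lin_sum lg).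
by apply: eq_bigr => j _; rewrite (linZ lf) (linZ lg) fg.
Qed.

Lemma hom_sumE (I : Type) (r : seq I) (F : I -> Hom) w :
  (\sum_(i <- r) F i) w = \sum_(i <- r) F i w.
Proof. by elim/big_rec2: _ => // i y x _ <-. Qed.

Local Notation N := (mult_module phi W).

(** The bound must be uniform in w; it is, because a homomorphism is determined by its values on a
    finite basis of W. *)
Lemma mult_mode_trunc (u : fixed_voa rho) (n : rat) (f : N) :
  exists k : nat, forall i, (k <= i)%N -> mmode u (n + i%:R) f = 0.
Proof.
have [k kP] := uniform_bound (fun j : 'I_(\dim {:W}) =>
  mmode_trunc hM (fixed_val u) n (hom_val f b`_j)).
by exists k => i ki; apply: hom_basisP => j; exact: kP.
Qed.

Lemma mult_weak_module : is_weak_module N.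
Proof.
split.
- move=> n f c u v; apply: hom_eqP => w.
  exact: (mmode_linearl hM n (hom_val f w) c (fixed_val u) (fixed_val v)).
- move=> u n c f g; apply: hom_eqP => w.
  exact: (mmode_linearr hM (fixed_val u) n c (hom_val f w) (hom_val g w)).
- move=> u f; have /choice[B BP] := fun j : 'I_(\dim {:W}) =>
    mmode_truncation hM (fixed_val u) (hom_val f b`_j).
  exists (\sum_j `|B j|) => n Bn; apply: hom_basisP => j; apply: BP.
  apply: le_trans Bn; rewrite (bigD1 j) //= (le_trans (ler_norm _)) // lerDl.
  by rewrite sumr_ge0.
- move=> n f; apply: hom_eqP => w.
  by rewrite /= (mmode_vacuum hM n (hom_val f w)); case: ifP.
- move=> u v f l m n.
  have [N1 h1] := mult_mode_trunc v n f.
  have [N2 h2] := mult_mode_trunc u m f.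
  have [N3 h3] := mode_trunc u l v.
  have [l0 r0] : (forall u n, mmode u n (0 : N) = 0) /\ (forall n f, mmode (0 : fixed_voa rho) n (f : N) = 0).
    split=> [u' n'|n' f']; apply: hom_eqP => w; [exact: mmode0r | exact: mmode0l].
  (* Finite ranges valid in the Hom space let evaluation at w pass through the sums. *)
  rewrite (@fsum_nat_trunc _ _ N1) => [|i /h1->]; last by rewrite l0 scaler0.
  rewrite (@fsum_nat_trunc _ _ N2) => [|i /h2->]; last by rewrite l0 scaler0.
  rewrite (@fsum_nat_trunc _ _ N3) => [|i /h3->]; last by rewrite r0 scaler0.
  apply: hom_eqP => w.
  have := @mmode_jacobi_trunc _ _ _ hM (fixed_val u) (fixed_val v) (hom_val f w) l m n N1 N2 N3.
  move=> /(_ _ _ _)/esym E.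
  transitivity (hom_val (\sum_(i < N1) ((-1) ^+ i * gbinom (l%:~R : R[i]) i) *:
      mmode u (m + l%:~R - i%:R) (mmode v (n + i%:R) f)) w
    - (-1) ^ l *: hom_val (\sum_(i < N2) ((-1) ^+ i * gbinom (l%:~R : R[i]) i) *:
      mmode v (n + l%:~R - i%:R) (mmode u (m + i%:R) f)) w) => //.
  rewrite !hom_sumE; symmetry.
  transitivity (if m \is a Num.int then hom_val (\sum_(i < N3) gbinom (ratr m : R[i]) i *:
         mmode (mode u (l + i%:Z) v) (m + n - i%:R) f) w else 0); first by case: ifP.
  rewrite hom_sumE; apply: E => i Ni.
  + by have := congr1 (fun f => hom_val f w) (h1 i Ni).
  + by have := congr1 (fun f => hom_val f w) (h2 i Ni).
  + by have := congr1 (fun v => fixed_val v) (h3 i Ni).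
Qed.

(** A homomorphism in the a-eigenspace maps the basis of W into the a-eigenspace of M, so dim W
    times n coordinates, not necessarily unique, determine it. *)
Lemma mult_fin_dim a : fin_dim (eigenspace_of (@mL _ _ N 0) a).
Proof.
have [irrm _ _] := irrP M; have [n [e eP]] := module_fin_dim irrm a.
pose D := \dim {:W}.
apply: (@fin_dim_coordinates _ _ _ (D * n) (fun r f => forall j : 'I_D,
  hom_val f b`_j = \sum_(k < n) (vec_mx r : 'M_(D, n)) j k *: e k)).
- move=> f Ef; have /choice[c cE] : forall j : 'I_D, exists c : 'I_n -> R[i],
    hom_val f b`_j = \sum_(k < n) c k *: e k.
    by move=> j; apply: eP; exact: (congr1 (fun f => hom_val f b`_j) Ef).
  exists (mxvec (\matrix_(j, k) c j k)) => j; rewrite mxvecK cE.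
  by apply: eq_bigr => k _; rewrite mxE.
- move=> c r f r' f' Ef Ef' j.
  transitivity (c *: hom_val f b`_j + hom_val f' b`_j) => //.
  rewrite Ef Ef' scaler_sumr -big_split; apply: eq_bigr => k _ /=.
  by rewrite linearP !mxE scalerDl scalerA.
- move=> f Ef; apply: hom_basisP => j; rewrite Ef big1 // => k _.
  by rewrite linear0 mxE scale0r.
Qed.

(** One list of distinct numbers kills the images of all basis vectors of W, hence f itself; the
    eigenvector decomposition then takes place inside the Hom space. *)
Lemma mult_graded : sum_subspaces (range (eigenspace_of (@mL _ _ N 0))) = setT.
Proof.
have [irrm _ _] := irrP M.
have lT : linear (@mL _ _ M 0) by exact: mmode_linearr.
have lS : linear (@mL _ _ N 0) by exact: (mmode_linearr mult_weak_module).
apply/seteqP; split=> // f _.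
have killE s g w : hom_val (kill (@mL _ _ N 0) s g) w =
    kill (@mL _ _ M 0) s (hom_val g w).
  by elim: s g => //= c s IH g; rewrite /kill /= -!/(kill _ s _) IH.
have /choice[s sP] : forall j : 'I_(\dim {:W}), exists s : seq R[i],
    forall s' : seq R[i], {subset s <= s'} -> kill (@mL _ _ M 0) s' (hom_val f b`_j) = 0.
  by move=> j; apply: (kill_sum_eigen lT); rewrite (module_graded irrm).
pose t := undup (flatten (codom s)).
have [|q [qE fE]] := kill_decomposition lS (undup_uniq _) (_ : kill _ t f = 0).
  apply: hom_basisP => j; rewrite killE; apply: sP => c cs; rewrite mem_undup.
  by apply/flattenP; exists (s j) => //; exact: codom_f.
exists [seq p.2 | p <- q]; split; last by rewrite big_map.
move=> g /mapP[p /qE[_ pE] ->]; by exists (eigenspace_of (@mL _ _ N 0) p.1).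
Qed.

Lemma mult_is_module : is_module N.
Proof.
have [irrm _ _] := irrP M; split.
- exact: mult_weak_module.
- exact: mult_graded.
- exact: mult_fin_dim.
- move=> a; have [B BP] := module_bounded irrm a; exists B => n nB.
  apply/seteqP; split=> f /=; last first.
    move=> ->; have E := lin0 (mmode_linearr mult_weak_module
      (conformal (fixed_voa rho)) (0%:~R + 1)).
    exact (etrans E (esym (scaler0 _ _))).
  move=> Ef; apply: hom_eqP => w.
  have : eigenspace_of (@mL _ _ M 0) (a + n%:~R) (hom_val f w).
    exact: (congr1 (fun f => hom_val f w) Ef).
  by rewrite BP.
Qed.

Lemma mult_mode_sumE (s : seq (fixed_voa rho * rat)) (f : N) w :
  hom_val (\sum_(p <- s) mmode p.1 p.2 f) w =
  \sum_(p <- s) mmode (fixed_val p.1) p.2 (hom_val f w).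
Proof. by rewrite hom_sumE. Qed.

(** For nonzero f, injectivity turns relations between the f(b_j) into relations between the b_j,
    which any g preserves; density then carries f to g by modes of V^G. *)
Lemma mult_irreducible : voa_simple V -> simple_module W -> irreducible_module N.
Proof.
move=> V_simple simW; split; first exact: mult_is_module.
  have [f [w fw]] := simple_module_occurs V_simple simW.1.
  by exists f; apply/eqP => f0; apply: fw; rewrite f0.
move=> P [sP mP]; have [P0|] := pselect (P `<=` [set 0]).
  by left; apply/seteqP; split=> // _ ->; exact: sP.1.
move=> /existsNP[f /not_implyP[Pf f0]]; right; apply/seteqP; split=> // g _.
have [lf fa] := hom_valP f; have [lg ga] := hom_valP g.
have finj : injective (hom_val f).
  apply: (simple_hom_inj simW (hom_valP f)); apply: contrapT => nf.
  apply: f0; apply: hom_eqP => w; apply: contrapT => fw; apply: nf.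
  by exists w.
have [|s sE] := @fixed_density _ _ _ _ _ phi 'I_(\dim {:W})
    (fun j => hom_val f b`_j) (fun j => hom_val g b`_j).
  move=> a E; have a0 : \sum_j fd_act W (a j) b`_j = 0.
    apply: finj; rewrite (lin0 lf) -[RHS]E (lin_sum lf).
    by apply: eq_bigr => j _; rewrite fa.
  transitivity (hom_val g (\sum_j fd_act W (a j) b`_j)); last by rewrite a0 lin0.
  by rewrite (lin_sum lg); apply: eq_bigr => j _; rewrite ga.
have -> : g = \sum_(p <- s) mmode (p.1 : fixed_voa rho) p.2 (f : N).
  by apply: hom_basisP => j; rewrite sE mult_mode_sumE.
by apply: (subspace_sum sP) => p _ _; exact: mP.
Qed.

End OneModule.

(** If the characters differ, the images of f and F f meet in 0, so density yields a combination of
    modes of V^G that fixes f and kills F f; as F commutes with it, F f = 0. *)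
Lemma mult_iso_character (W1 W2 : fd_module A) : voa_simple V ->
  simple_module W1 -> simple_module W2 ->
  module_iso (mult_module phi W1) (mult_module phi W2) ->
  character W1 = character W2.
Proof.
move=> V_simple sim1 sim2 [F [lF bF Fm]]; apply: contrapT => chi.
have [f [w0 fw0]] := simple_module_occurs V_simple sim1.1.
set f' : hom_space W2 (tga_action phi) := F f.
have [l1 a1] := hom_valP f; have [l2 a2] := hom_valP f'.
have inj1 : injective (hom_val f).
  by apply: (simple_hom_inj sim1 (hom_valP f)); exists w0.
have f'0 : f' <> 0.
  move=> f'0; apply: fw0; suff -> : f = 0 by [].
  by apply: (bij_inj bF); rewrite (lin0 lF).
have inj2 : injective (hom_val f').
  apply: (simple_hom_inj sim2 (hom_valP f')); apply: contrapT => nf.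
  apply: f'0; apply: hom_eqP => w; apply: contrapT => fw; apply: nf.
  by exists w.
pose J := ('I_(\dim {:W1}) + 'I_(\dim {:W2}))%type.
pose x (j : J) := match j with
  | inl i => hom_val f (vbasis {:W1})`_i | inr i => hom_val f' (vbasis {:W2})`_i end.
pose y (j : J) := match j with inl i => hom_val f (vbasis {:W1})`_i | inr i => 0 end.
have [|s sE] := @fixed_density _ _ _ _ _ phi J x y.
  move=> a; rewrite !big_sumType /= => E.
  rewrite [X in _ + X]big1 ?addr0 => [|i _]; last first.
    exact: (lin0 (act_linearr (tga_action phi) _)).
  pose w1 := \sum_i fd_act W1 (a (inl i)) (vbasis {:W1})`_i.
  pose w2 := \sum_i fd_act W2 (a (inr i)) (vbasis {:W2})`_i.
  have f1E : hom_val f w1 = \sum_i tga_act (a (inl i)) (hom_val f (vbasis {:W1})`_i).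
    by rewrite (lin_sum l1); apply: eq_bigr => i _; rewrite a1.
  have f2E : hom_val f' w2 = \sum_i tga_act (a (inr i)) (hom_val f' (vbasis {:W2})`_i).
    by rewrite (lin_sum l2); apply: eq_bigr => i _; rewrite a2.
  rewrite -f1E; suff -> : w1 = 0 by exact: lin0.
  apply: (simple_hom_disjoint sim1 sim2 (hom_valP f) (hom_valP f') inj1 inj2 chi (w2 := w2)).
  by rewrite f1E f2E.
apply: f'0; have fE : f = \sum_(p <- s) mmode (p.1 : fixed_voa rho) p.2 (f : mult_module phi W1).
  by apply: hom_basisP => j; rewrite mult_mode_sumE; exact: (sE (inl j)).
rewrite /f' fE (lin_sum lF); under eq_bigr do rewrite Fm.
by apply: hom_basisP => j; rewrite mult_mode_sumE; exact: esym (sE (inr j)).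
Qed.

End MultiplicityModules.

(** * The dual pair formed by the fixed points and the twisted group algebra *)

Theorem theorem6p1 (R : realType) (V : voa R) (V_simple : voa_simple V)
    (G : finGroupType) (rho : aut_group V G)
    (M : irr_module V) (phi : proj_action rho M)
    (W : (tga (alpha_cocycle phi) -> R[i]) -> fd_module (tga (alpha_cocycle phi)))
    (W_simple : forall lambda, irr_characters (tga (alpha_cocycle phi)) lambda ->
       simple_module (W lambda) /\ character (W lambda) = lambda) :
  [/\ forall lambda, irr_characters (tga (alpha_cocycle phi)) lambda ->
        isotypic (W lambda) (tga_action phi) <> [set 0],
      forall lambda, irr_characters (tga (alpha_cocycle phi)) lambda ->
        irreducible_module (mult_module phi (W lambda)) &
      forall lambda gamma, irr_characters (tga (alpha_cocycle phi)) lambda ->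
        irr_characters (tga (alpha_cocycle phi)) gamma ->
        module_iso (mult_module phi (W lambda)) (mult_module phi (W gamma))
        <-> lambda = gamma].
Proof.
split=> [lambda /W_simple[sim _]|lambda /W_simple[sim _]|lambda gamma].
- have [f fw] := simple_module_occurs V_simple sim.1.
  exact: (simple_isotypic sim (hom_valP f) fw).
- exact: mult_irreducible.
- move=> /W_simple[sim1 chi1] /W_simple[sim2 chi2]; split=> [iso|->].
    by rewrite -chi1 -chi2; exact: (mult_iso_character V_simple sim1 sim2).
  by exists id; split=> //; exists id.
Qed.
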